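(* Let $m\ge 2$ be an integer, and let $A$ be the area (two-dimensional Lebesgue measure) of the region enclosed by the $m$-leafed symmetric lemniscate $\{w\in\mathbb{C} : |w^m-1|=1\}$, the boundary being described by $w=\Psi(z)=z\left(1+\frac{1}{z^m}\right)^{1/m}$ as $z$ describes the unit circle $|z|=1$. Then $$A=\pi\left(\sum_{n=0}^{\infty}\left(C_n^{1/m}\right)^2-m\sum_{n=1}^{\infty}n\left(C_n^{1/m}\right)^2\right),$$ and hence $$A=2^{\frac{2}{m}-1}\,\frac{\Gamma\left(\frac{1}{m}+\frac12\right)}{\Gamma\left(\frac1m+1\right)}\,\sqrt{\pi}.$$
   Context: For real $\alpha$ and an integer $n\ge 0$, $C_n^{\alpha}=\frac{\alpha(\alpha-1)\cdots(\alpha-n+1)}{n!}$ denotes the generalized binomial coefficient (with $C_0^\alpha=1$). $\Gamma$ is the Gamma function. The region enclosed by the $m$-leafed symmetric lemniscate is $\{w\in\mathbb{C}: |w^m-1|<1\}$ (the union of the interiors of the $m$ leaves). The map $\Psi(z)=z(1+z^{-m})^{1/m}$, with the principal branch of the $m$-th root, is the conformal mapping from the exterior $|z|>1$ of the unit disk onto the exterior of the lemniscate; its boundary values on $|z|=1$ satisfy $w^m=z^m+1$, so $|w^m-1|=1$. *)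

(* Defs.v *)
From HB Require Import structures.
From mathcomp Require Import all_boot all_order all_algebra.
From mathcomp Require Import complex.
From mathcomp Require Import all_classical all_reals all_analysis.

Set Implicit Arguments.
Unset Strict Implicit.
Unset Printing Implicit Defensive.

Import Order.TTheory GRing.Theory Num.Theory.
Import numFieldNormedType.Exports.

Local Open Scope classical_set_scope.
Local Open Scope ring_scope.
Local Open Scope complex_scope.

Definition gbinom (R : realType) (a : R) (n : nat) : R :=
  (\prod_(i < n) (a - i%:R)) / n`!%:R.

(* Euler's integral; it converges, and equals Gamma(x), exactly for 0 < x. *)
Definition Gamma (R : realType) (x : R) : R :=
  \int[lebesgue_measure]_(t in `]0, +oo[) (t `^ (x - 1) * expR (- t)).

(* The argument in ]- pi, pi]. Its value at z = 0 is irrelevant. *)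
Definition principal_arg (R : realType) (z : R[i]) : R :=
  let t := acos (complex.Re z / Normc.normc z) in
  if 0 <= complex.Im z then t else - t.

(* The principal branch of the m-th root. The library's m.-root is another
   branch: it picks the m-th root with the least nonnegative argument. For
   0 < m the value at z = 0 is 0. *)
Definition principal_root (R : realType) (m : nat) (z : R[i]) : R[i] :=
  let r := Normc.normc z `^ m%:R^-1 in
  let t := principal_arg z / m%:R in
  (r * cos t) +i* (r * sin t).

Definition Psi (R : realType) (m : nat) (z : R[i]) : R[i] :=
  z * principal_root m (1 + z ^- m).

(* The norm on R[i] takes its values in (the real elements of) R[i]. *)
Definition lemniscate (R : realType) (m : nat) : set R[i] :=
  [set w | `|w ^+ m - 1| = 1].

Definition lemniscate_region (R : realType) (m : nat) : set R[i] :=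
  [set w | `|w ^+ m - 1| < 1].

(* Two-dimensional Lebesgue measure, under the identification of R[i]
   with R * R. *)
Definition area (R : realType) (D : set R[i]) : \bar R :=
  (@lebesgue_measure R \x @lebesgue_measure R)%E
    [set p : R * R | D (p.1 +i* p.2)].

(* Main.v *)
Require Import Defs.
From HB Require Import structures.
From mathcomp Require Import all_boot all_order all_algebra.
From mathcomp Require Import complex.
From mathcomp Require Import all_classical all_reals all_analysis.
From mathcomp Require Import measurable_realfun ring lra.

Set Implicit Arguments.
Unset Strict Implicit.
Unset Printing Implicit Defensive.

Import Order.TTheory GRing.Theory Num.Theory.
Import numFieldNormedType.Exports.

Local Open Scope classical_set_scope.
Local Open Scope ring_scope.

(** Write a = 1/m and t_n for the square of the n-th binomial coefficient of
exponent a. Both formulas come down to the integral I(s) of cos^s over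
[-pi/2, pi/2]: the area is (4^a / 2) I(2a), and the series and the Gamma
quotient are two evaluations of this number.

Area. In polar coordinates |w^m - 1| < 1 reads r^m < 2 cos (m theta). The
polar change of variables is carried out with the slope t = tan theta in place
of the angle: substituting y = x t on the vertical line above x multiplies
lengths by |x|, so the area is the integral over t of the integral of |x| along
the line of slope t ([area_slopes]). That line meets the region in two segments
issued from the origin, so the inner integral is explicit in atan t
([integral_lemniscate_region_slope]). The outer one is a difference of values of
an antiderivative of the 2a-th power of the positive part of cos, over m periods
of that function, one for each leaf; the factor m cancels against the m of
d(m theta) ([area_lemniscate_region]).

Cosine integrals. Integration by parts gives (s + 2) I(s + 2) = (s + 1) I(s), and
I is nonincreasing; as in Wallis's argument, I(2a) is pi times the limit of a
product of rational factors ([cos_int_wallis]). The inequality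
Gamma (x + s) <= x^s Gamma x for 0 <= s <= 1 shows that Gamma (x + s) / Gamma x
is equivalent to x^s, which turns this limit into a quotient of Gamma values
([wallis_cvg]). The exponent 1, where I is 2, gives Gamma (1/2) = sqrt pi.

Series. The sum of (a^2 - 2 a n) t_n over n < N telescopes to N^2 t_N, which
tends to 0; hence the sum of n t_n is a/2 times the sum of t_n, and the bracket
of the first formula is half the sum of the t_n ([gauss_sum_gosper]). Gauss's
theorem evaluates this sum: it is the value at c = 1 of the hypergeometric series
2F1(-a, -a; c; 1), a contiguous relation links the values at c and c + 1, and the
value tends to 1 as c grows; so the sum is an infinite product
([gauss_sum_prod]). Grouping its factors two by two gives the Wallis product
times the square of the product of the 1 + a/k for N < k <= 2N, which tends to 2^a
([gauss_sum_wallis]).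

Boundary. Psi(z)^m = z^m + 1, so the circle is mapped into the lemniscate;
multiplying z by m-th roots of unity reaches every point ([Psi_unit_circle]). *)

(** * The hypergeometric series of squared binomial coefficients *)

Section GaussSum.
Context {R : realType}.
Implicit Types (a : R) (k n : nat).

(** The terms of the series 2F1(-a, -a; c; 1) for c = k + 1. The case k = 0 is the
one of interest; the others make Gauss's induction on c possible. *)
Definition gauss_term a k n : R :=
  \prod_(i < n) ((a - i%:R) ^+ 2 / ((k + i).+1%:R * i.+1%:R)).

Lemma gauss_term0 a k : gauss_term a k 0 = 1.
Proof. by rewrite /gauss_term big_ord0. Qed.

Lemma gauss_termS a k n : gauss_term a k n.+1 =
  gauss_term a k n * ((a - n%:R) ^+ 2 / ((k + n).+1%:R * n.+1%:R)).
Proof. by rewrite /gauss_term big_ord_recr. Qed.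

Lemma gauss_term_gbinom a n : gauss_term a 0 n = gbinom a n ^+ 2.
Proof.
elim: n => [|n IH].
  by rewrite gauss_term0 /gbinom big_ord0 fact0 divr1 expr1n.
rewrite gauss_termS IH /gbinom big_ord_recr/= factS natrM add0n.
have h1 : n.+1%:R != 0 :> R by rewrite pnatr_eq0.
have h2 : n`!%:R != 0 :> R by rewrite pnatr_eq0 -lt0n fact_gt0.
by field; apply/andP; split.
Qed.

Lemma gauss_term_ge0 a k n : 0 <= gauss_term a k n.
Proof. by apply: prodr_ge0 => i _;
  rewrite mulr_ge0 ?sqr_ge0// invr_ge0 mulr_ge0. Qed.

Lemma gauss_term_shift a k n :
  gauss_term a k.+1 n * (k + n).+1%:R = gauss_term a k n * k.+1%:R.
Proof.
elim: n => [|n IH]; first by rewrite !gauss_term0 addn0.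
rewrite !gauss_termS.
have h0 : n.+1%:R != 0 :> R by rewrite pnatr_eq0.
have h1 : (k + n).+1%:R != 0 :> R by rewrite pnatr_eq0.
have h2 : (k.+1 + n).+1%:R != 0 :> R by rewrite pnatr_eq0.
have -> : gauss_term a k n = gauss_term a k.+1 n * (k + n).+1%:R / k.+1%:R.
  by rewrite IH mulfK // pnatr_eq0.
have -> : (k + n.+1).+1 = (k.+1 + n).+1 by rewrite addSnnS.
have h3 : k.+1%:R != 0 :> R by rewrite pnatr_eq0.
by field; do ?[apply/andP; split].
Qed.

(** Since (n + 1)^2 t_(n+1) = (a - n)^2 t_n for k = 0, the sequence n^2 t_n has
increments (a^2 - 2 a n) t_n. *)
Lemma gauss_term_gosper a n :
  \sum_(0 <= i < n) (a ^+ 2 - 2 * a * i%:R) * gauss_term a 0 i =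
  n%:R ^+ 2 * gauss_term a 0 n.
Proof.
elim: n => [|n IH]; first by rewrite big_geq// expr0n mul0r.
rewrite big_nat_recr//= IH gauss_termS add0n.
have h1 : n.+1%:R != 0 :> R by rewrite pnatr_eq0.
by field.
Qed.

(** Creative telescoping in the parameter c: the relation between the sums at c and
c + 1 holds for the terms up to the increment of - c n t_n, and n t_n tends
to 0. *)
Lemma gauss_term_contiguous a k n : let c : R := k.+1%:R in
  \sum_(0 <= i < n) (c * (c + 2 * a) * gauss_term a k i
                     - (c + a) ^+ 2 * gauss_term a k.+1 i) =
  - (c * (n%:R * gauss_term a k n)).
Proof.
move=> c; elim: n => [|n IH]; first by rewrite big_geq// mul0r mulr0 oppr0.
rewrite big_nat_recr//= IH gauss_termS.
have := gauss_term_shift a k n.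
have h1 : n.+1%:R != 0 :> R by rewrite pnatr_eq0.
have h2 : (k + n).+1%:R != 0 :> R by rewrite pnatr_eq0.
move=> /(canRL (mulfK h2)) ->; rewrite -/c.
have e : (k + n).+1%:R = c + n%:R by rewrite /c -natrD addSn.
rewrite e in h2 *.
by field; apply/andP; split.
Qed.

Local Notation weighted_term a := (fun n => n%:R * gauss_term a 0 n).

Lemma gauss_term_gosper_series a n :
  a ^+ 2 * series (gauss_term a 0) n - 2 * a * series (weighted_term a) n =
  n%:R ^+ 2 * gauss_term a 0 n.
Proof.
rewrite -gauss_term_gosper /series/= !mulr_sumr -sumrB; apply: eq_bigr => i _.
by rewrite mulrBl !mulrA.
Qed.

(** Let A and B be the two partial sums. The telescoped identity has a nonnegative
right-hand side, so 2 B <= a A, and A <= 1 + B because t_0 = 1 and t_n <= n t_n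
afterwards. As a < 1, these two inequalities bound both sums. *)
Lemma gauss_series_bounded a n : 0 < a < 1 ->
  series (gauss_term a 0) n <= 2 /\ series (weighted_term a) n <= 1.
Proof.
move=> /andP[a0 a1].
have h := gauss_term_gosper_series a n.
have p : 0 <= n%:R ^+ 2 * gauss_term a 0 n.
  by rewrite mulr_ge0 ?sqr_ge0 ?gauss_term_ge0.
have q : series (gauss_term a 0) n <= 1 + series (weighted_term a) n.
  rewrite /series/=; case: n {h p} => [|n]; first by rewrite !big_geq// addr0.
  rewrite !(big_nat_recl _ 0)//= gauss_term0 mul0r add0r lerD2l.
  apply: ler_sum => i _; rewrite ler_peMl// ?gauss_term_ge0//.
  by rewrite ler1n.
have r : 2 * series (weighted_term a) n <= a * series (gauss_term a 0) n.
  by rewrite -(ler_pM2l a0) -subr_ge0; move: p; rewrite -h; lra.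
have r1 : 0 <= series (weighted_term a) n.
  by rewrite /series/=; apply: sumr_ge0 => i _; rewrite mulr_ge0 ?gauss_term_ge0.
have w : series (weighted_term a) n <= 1 by nra.
split => //; lra.
Qed.

Lemma cvg_gauss_sum0 a : 0 < a < 1 -> cvgn (series (gauss_term a 0)).
Proof.
move=> ha; apply: nondecreasing_is_cvgn.
  by apply: nondecreasing_series => n _ _; exact: gauss_term_ge0.
by exists 2 => _ [n _ <-]; exact: (gauss_series_bounded n ha).1.
Qed.

Lemma cvg_gauss_sum1 a : 0 < a < 1 ->
  cvgn (series (weighted_term a)).
Proof.
move=> ha; apply: nondecreasing_is_cvgn.
  by apply: nondecreasing_series => n _ _; rewrite mulr_ge0 ?gauss_term_ge0.
by exists 1 => _ [n _ <-]; exact: (gauss_series_bounded n ha).2.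
Qed.

(** It has to be shown that n^2 t_n tends to 0. It is nonincreasing from n = 1 on,
because (a - n)^2 <= n^2; if its limit L were positive, n t_n >= L / n would make
the harmonic series converge. *)
Lemma gauss_sum_gosper a : 0 < a < 1 ->
  a * limn (series (gauss_term a 0)) =
  2 * limn (series (weighted_term a)).
Proof.
move=> ha; move: (ha) => /andP[a0 a1].
have c0 := cvg_gauss_sum0 ha; have c1 := cvg_gauss_sum1 ha.
set l0 := limn _; set l1 := limn _.
pose u n := n%:R ^+ 2 * gauss_term a 0 n.
have cu : u @ \oo --> a ^+ 2 * l0 - 2 * a * l1.
  rewrite (_ : u = fun n => a ^+ 2 * series (gauss_term a 0) n - 2 * a * series
    (weighted_term a) n); last first.
    by apply/funext => n; rewrite gauss_term_gosper_series.
  by apply: cvgB; apply: cvgM => //; exact: cvg_cst.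
have du : nonincreasing_seq (fun n => u n.+1).
  apply/nonincreasing_seqP => n; rewrite /u gauss_termS add0n.
  have h2 : n.+2%:R != 0 :> R by rewrite pnatr_eq0.
  have -> : n.+2%:R ^+ 2 *
    (gauss_term a 0 n.+1 * ((a - n.+1%:R) ^+ 2 / (n.+2%:R * n.+2%:R)))
      = (n.+1%:R - a) ^+ 2 * gauss_term a 0 n.+1 by field.
  rewrite ler_wpM2r ?gauss_term_ge0// ler_sqr ?nnegrE//; first by lra.
  by rewrite subr_ge0 (le_trans (ltW a1))// ler1n.
have cu1 : (fun n => u n.+1) @ \oo --> a ^+ 2 * l0 - 2 * a * l1.
  by rewrite (cvg_shiftS u).
have lu n : a ^+ 2 * l0 - 2 * a * l1 <= u n.+1.
  rewrite -(cvg_lim (@Rhausdorff R) cu1).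
  by apply: (nonincreasing_cvgn_ge du); apply/cvg_ex;
    exists (a ^+ 2 * l0 - 2 * a * l1).
have L0 : a ^+ 2 * l0 - 2 * a * l1 <= 0.
  rewrite leNgt; apply/negP => L0; apply: (@dvg_harmonic R).
  set L := a ^+ 2 * l0 - 2 * a * l1 in L0 lu.
  have -> : (@harmonic R) = L^-1 *: (fun n => L * harmonic n).
    by apply/funext => n /=; rewrite fctE scalerA mulVf ?gt_eqF// scale1r.
  apply: is_cvg_seriesZ.
  apply: (@series_le_cvg _ _ (fun n => n.+1%:R * gauss_term a 0 n.+1)).
  - by move=> n; rewrite mulr_ge0 ?harmonic_ge0// ltW.
  - by move=> n; rewrite mulr_ge0 ?gauss_term_ge0.
  - move=> n; have := lu n; rewrite /u/= ler_pdivrMr// => /le_trans -> //.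
    by rewrite expr2 mulrAC.
  have /cvg_ex[l hl] := c1.
  apply/cvg_ex; exists l.
  move: hl; rewrite -(cvg_shiftS (series (weighted_term a))).
  suff <- : (fun n => series (weighted_term a) n.+1) =
    series (fun n => n.+1%:R * gauss_term a 0 n.+1) by [].
  by apply/funext => n; rewrite /series/= big_nat_recl//= mul0r add0r.
have L1 : 0 <= a ^+ 2 * l0 - 2 * a * l1.
  rewrite -(cvg_lim (@Rhausdorff R) cu); apply: limr_ge.
    by apply/cvg_ex; eexists; exact: cu.
  by apply: nearW => n; rewrite mulr_ge0 ?sqr_ge0 ?gauss_term_ge0.
have : a ^+ 2 * l0 - 2 * a * l1 = 0 by apply/eqP; rewrite eq_le L0 L1.
move=> h; apply: (@mulfI _ a); first by rewrite gt_eqF.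
by apply/eqP; rewrite -subr_eq0 -h; apply/eqP; ring.
Qed.

(** Of the n quotients (i + 1) / (k + i + 1), the first is 1 / (k + 1) and the
others are at most 1. *)
Lemma gauss_term_le a k n : (0 < n)%N ->
  gauss_term a k n <= gauss_term a 0 n / k.+1%:R.
Proof.
case: n => // n _; elim: n => [|n IH].
  rewrite !gauss_termS !gauss_term0 !mul1r addn0 !mulr1 subr0.
  by rewrite invr1 mulr1.
rewrite gauss_termS (gauss_termS _ 0) add0n [leRHS]mulrAC.
apply: (le_trans (ler_wpM2r _ IH));
  first by rewrite mulr_ge0 ?sqr_ge0 ?invr_ge0 ?mulr_ge0.
rewrite ler_wpM2l//; first by rewrite mulr_ge0 ?gauss_term_ge0.
rewrite ler_wpM2l ?sqr_ge0// lef_pV2 ?posrE ?mulr_gt0// ler_wpM2r// ler_nat.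
by rewrite ltnS leq_addl.
Qed.

Lemma gauss_term_le0 a k n : gauss_term a k n <= gauss_term a 0 n.
Proof.
case: n => [|n]; first by rewrite !gauss_term0.
apply: (le_trans (gauss_term_le _ _ _)) => //.
by rewrite ler_pdivrMr// ler_peMr ?gauss_term_ge0// ler1n.
Qed.

Lemma cvg_gauss_sum a k : 0 < a < 1 -> cvgn (series (gauss_term a k)).
Proof.
move=> ha; apply: (series_le_cvg _ _ (gauss_term_le0 a k) (cvg_gauss_sum0 ha)).
  exact: gauss_term_ge0.
exact: gauss_term_ge0.
Qed.

Definition gauss_sum a k : R := limn (series (gauss_term a k)).

Lemma gauss_sum_contiguous a k : 0 < a < 1 -> let c : R := k.+1%:R in
  c * (c + 2 * a) * gauss_sum a k = (c + a) ^+ 2 * gauss_sum a k.+1.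
Proof.
move=> ha c; apply/eqP; rewrite -subr_eq0; apply/eqP.
have c0 := @cvg_gauss_sum a k ha; have c1 := @cvg_gauss_sum a k.+1 ha.
have h1 : (fun n => c * (c + 2 * a) * series (gauss_term a k) n - (c + a) ^+ 2
  * series (gauss_term a k.+1) n) @ \oo -->
   c * (c + 2 * a) * gauss_sum a k - (c + a) ^+ 2 * gauss_sum a k.+1.
  by apply: cvgB; apply: cvgM => //; exact: cvg_cst.
have h2 : (fun n => c * (c + 2 * a) * series (gauss_term a k) n - (c + a) ^+ 2
  * series (gauss_term a k.+1) n) @ \oo --> (0 : R).
  rewrite (_ : (fun n => _) = fun n => - (c * (n%:R * gauss_term a k n)));
    last first.
    apply/funext => n; rewrite -gauss_term_contiguous /series/= !mulr_sumr
      -sumrB.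
    by apply: eq_bigr.
  rewrite -oppr0; apply: cvgN; rewrite -(mulr0 c); apply: cvgM;
    first exact: cvg_cst.
  have h := cvg_series_cvg_0 (cvg_gauss_sum1 ha).
  apply: squeeze_cvgr (cvg_cst 0) h; apply: nearW => n.
  by rewrite mulr_ge0 ?gauss_term_ge0//= ler_wpM2l// gauss_term_le0.
exact: (cvg_unique _ h1 h2).
Qed.

(** All terms after the first are at most 1 / (k + 1) times those of the series for
k = 0. *)
Lemma gauss_sum_cvg1 a : 0 < a < 1 -> gauss_sum a k @[k --> \oo] --> (1 : R).
Proof.
move=> ha.
have sh k : (fun n => 1 + \sum_(0 <= i < n) gauss_term a k i.+1) @ \oo -->
  gauss_sum a k.
  have : series (gauss_term a k) @ \oo --> gauss_sum a k by exact:
    cvg_gauss_sum.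
  rewrite -(cvg_shiftS (series (gauss_term a k))).
  suff <- : (fun n => series (gauss_term a k) n.+1) =
    (fun n => 1 + \sum_(0 <= i < n) gauss_term a k i.+1) by [].
  by apply/funext => n; rewrite /series/= big_nat_recl//= gauss_term0.
apply: (@squeeze_cvgr _ _ _ _ (fun=> 1) (fun k => 1 + (gauss_sum a 0 - 1) *
  k.+1%:R^-1)).
- apply: nearW => k; apply/andP; split.
    rewrite -(cvg_lim (@Rhausdorff R) (sh k)); apply: limr_ge.
      by apply/cvg_ex; eexists; exact: sh.
    by apply: nearW => n; rewrite lerDl sumr_ge0// => i _;
      exact: gauss_term_ge0.
  rewrite -lerBlDl.
  have s0 : (fun n => (1 + \sum_(0 <= i < n) gauss_term a 0 i.+1 - 1) *
    k.+1%:R^-1) @ \oo --> (gauss_sum a 0 - 1) * k.+1%:R^-1.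
    by apply: cvgM; [apply: cvgB => //; exact: cvg_cst|exact: cvg_cst].
  have s1 : (fun n => (1 + \sum_(0 <= i < n) gauss_term a k i.+1 - 1)) @ \oo
    --> (gauss_sum a k - 1).
    by apply: cvgB => //; exact: cvg_cst.
  apply: (ler_cvg_to s1 s0).
  apply: nearW => n; rewrite !(addrC 1) !addrK mulr_suml.
  by apply: ler_sum => i _; exact: gauss_term_le.
- exact: cvg_cst.
- rewrite -[X in _ --> X]addr0; apply: cvgD; first exact: cvg_cst.
  rewrite -(mulr0 (gauss_sum a 0 - 1)); apply: cvgM; first exact: cvg_cst.
  exact: cvg_harmonic.
Qed.

(** Iterating the contiguous relation n times writes the sum at c = 1 as a product
of n factors times the sum at c = n + 1, which tends to 1. *)
Lemma gauss_sum_prod a : 0 < a < 1 ->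
  \prod_(i < n) ((i.+1%:R + a) ^+ 2 / (i.+1%:R * (i.+1%:R + 2 * a)))
    @[n --> \oo] -->
  gauss_sum a 0.
Proof.
move=> ha; move: (ha) => /andP[a0 a1].
have e n : gauss_sum a 0 =
  (\prod_(i < n) ((i.+1%:R + a) ^+ 2 / (i.+1%:R * (i.+1%:R + 2 * a)))) *
    gauss_sum a n.
  elim: n => [|n IH]; first by rewrite big_ord0 mul1r.
  rewrite {1}IH big_ord_recr/= -mulrA; congr (_ * _).
  have := @gauss_sum_contiguous a n ha => /= h.
  have p1 : n.+1%:R != 0 :> R by rewrite pnatr_eq0.
  have p2 : n.+1%:R + 2 * a != 0 :> R.
    by rewrite gt_eqF// addr_gt0 ?ltr0n ?mulr_gt0.
  apply: (mulfI (mulf_neq0 p1 p2)); rewrite h; field.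
  by rewrite nat1r p1 p2.
have g0 n : 0 < gauss_sum a n.
  apply: (@lt_le_trans _ _ 1) => //.
  have c := @cvg_gauss_sum a n ha.
  apply: limr_ge => //.
  exists 1%N => // -[//|j] _ /=.
  by rewrite /series/= big_nat_recl// gauss_term0 lerDl sumr_ge0// => i _;
    exact: gauss_term_ge0.
rewrite (_ : (fun n => _) = fun n => gauss_sum a 0 / gauss_sum a n); last first.
  by apply/funext => n; rewrite {1}(e n) mulfK// gt_eqF.
rewrite -[X in _ --> X]divr1; apply: cvgM; first exact: cvg_cst.
by apply: cvgV => //; exact: gauss_sum_cvg1.
Qed.

End GaussSum.

(** * Integrals over domains exhausted by segments *)

Section Calculus.
Context {R : realType}.
Local Notation mu := (@lebesgue_measure R).
Implicit Types (f F : R -> R).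

Lemma is_derive1_continuous F (x df : R) : is_derive x 1 F df ->
  {for x, continuous F}.
Proof. by move=> [dF _]; exact/differentiable_continuous/derivable1_diffP. Qed.

Lemma continuous_in_within f (D : set R) :
  (forall x, D x -> {for x, continuous f}) -> {within D, continuous f}.
Proof.
move=> cf; apply: continuous_in_subspaceT => x /set_mem Dx; exact: cf.
Qed.

Lemma is_derive_LRcontinuous F f (a b : R) : a < b ->
  (forall x, a <= x <= b -> is_derive x 1 F (f x)) ->
  derivable_oo_LRcontinuous F a b.
Proof.
move=> ab dF; split.
- by move=> x; rewrite in_itv/= => /andP[/ltW ax /ltW xb]; case: (dF x);
  rewrite ?ax.
- apply: cvg_at_right_filter; apply: (is_derive1_continuous (dF a _)).
  by rewrite lexx ltW.
- apply: cvg_at_left_filter; apply: (is_derive1_continuous (dF b _)).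
  by rewrite lexx ltW.
Qed.

Lemma is_derive_FTC2 F f (a b : R) : a < b ->
  (forall x, a <= x <= b -> is_derive x 1 F (f x)) ->
  (forall x, a <= x <= b -> {for x, continuous f}) ->
  (\int[mu]_(x in `[a, b]) (f x)%:E = (F b - F a)%:E)%E.
Proof.
move=> ab dF cf; rewrite EFinB; apply: continuous_FTC2 => //.
- by apply: continuous_in_within => x /=; rewrite in_itv/=; exact: cf.
- exact: (is_derive_LRcontinuous _ dF).
- move=> x; rewrite in_itv/= => /andP[/ltW ax /ltW xb].
  by have [] := dF x; rewrite ?ax// derive1E.
Qed.

Lemma in_continuous_measurable f (D : set R) : measurable D ->
  (forall x, D x -> {for x, continuous f}) -> measurable_fun D f.
Proof.
move=> mD cf; apply: subspace_continuous_measurable_fun => //.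
exact: continuous_in_within.
Qed.

Section exhaustion.
Context (a b : R^nat) (D : set R) (na : nonincreasing_seq a)
  (nb : nondecreasing_seq b) (UD : \bigcup_n `[a n, b n]%classic = D).

(** By monotone convergence. The limit is taken in the extended reals, so this can
serve to decide whether the improper integral is finite. *)
Lemma exhaust_integral f :
  (forall x, D x -> 0 <= f x) -> (forall x, D x -> {for x, continuous f}) ->
  (\int[mu]_(x in `[a n, b n]) (f x)%:E)%E @[n --> \oo] -->
  (\int[mu]_(x in D) (f x)%:E)%E.
Proof.
move=> f0 cf; rewrite -UD.
have sD n x : `[a n, b n]%classic x -> D x by rewrite -UD => ?; exists n.
apply: (@ge0_nondecreasing_set_cvg_integral _ (measurableTypeR R) R (fun n =>
  `[a n, b n]%classic) (EFin \o f) mu) => //.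
- apply/nondecreasing_seqP => n; rewrite subsetEset; apply: subset_itv.
    by rewrite bnd_simp na.
  by rewrite bnd_simp nb.
- move=> n; apply/measurable_EFinP; apply: in_continuous_measurable => // x h.
  by apply: cf; exact: sD h.
- by move=> n x h; rewrite /= lee_fin; apply: f0; exact: sD h.
Qed.

Lemma ge0_FTC2_exhaust F f (la lb : R) : (forall n, a n < b n) ->
  (forall x, D x -> 0 <= f x) -> (forall x, D x -> {for x, continuous f}) ->
  (forall x, D x -> is_derive x 1 F (f x)) ->
  F (a n) @[n --> \oo] --> la -> F (b n) @[n --> \oo] --> lb ->
  (\int[mu]_(x in D) (f x)%:E = (lb - la)%:E)%E.
Proof.
move=> ab f0 cf dF Fa Fb.
have sD n x : a n <= x <= b n -> D x.
  by rewrite -UD => ?; exists n => //=; rewrite in_itv.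
have h := exhaust_integral f0 cf.
apply: (cvg_unique _ h) => //.
rewrite (_ : (fun n => _) = fun n => (F (b n) - F (a n))%:E); last first.
  apply/funext => n; apply: is_derive_FTC2 => // x /sD Dx;
    [exact: dF|exact: cf].
by apply: cvg_EFin; [exact: nearW|exact: cvgB].
Qed.

End exhaustion.

Lemma bigcup_itv_pos : \bigcup_n `[(n.+1%:R^-1 : R), n.+2%:R]%classic =
  `]0, +oo[%classic.
Proof.
apply/seteqP; split => x /=.
  by move=> [n _]; rewrite /= !in_itv/= andbT => /andP[h _];
    apply: lt_le_trans h.
rewrite in_itv/= andbT => x0.
exists (maxn (Num.truncn x) (Num.truncn x^-1)) => //=; rewrite in_itv/=;
  apply/andP; split.
  rewrite -[leRHS]invrK lef_pV2 ?posrE ?invr_gt0//.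
  rewrite (le_trans (ltW (truncnS_gt _)))// ler_nat ltnS leq_maxr//.
rewrite (le_trans (ltW (truncnS_gt _)))// ler_nat ltnS leqW// leq_maxl//.
Qed.

Lemma bigcup_itv_setT : \bigcup_n `[- (n.+1%:R : R), n.+1%:R]%classic = setT.
Proof.
apply/seteqP; split => x //= _.
exists (Num.truncn `|x|) => //=; rewrite in_itv/= -ler_norml.
exact: (ltW (truncnS_gt _)).
Qed.

End Calculus.

(** * Euler's Gamma integral *)

Section Gamma.
Context {R : realType}.
Local Notation mu := (@lebesgue_measure R).
Implicit Types (x t s : R).

Definition Gamma_integrand x t : R := t `^ (x - 1) * expR (- t).

(** Euler's integral with values in the extended reals: the functional equation is
established there, and finiteness is deduced from it. *)
Definition eGamma x : \bar R :=
  (\int[mu]_(t in `]0%R, +oo[) (Gamma_integrand x t)%:E)%E.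

Lemma Gamma_integrand_ge0 x t : 0 <= Gamma_integrand x t.
Proof. by rewrite mulr_ge0 ?powR_ge0 ?expR_ge0. Qed.

#[local] Hint Resolve Gamma_integrand_ge0 : core.

Let itv_pos t : [set` `]0%R, +oo[] t -> 0 < t.
Proof. by rewrite /= in_itv/= andbT. Qed.

Lemma is_derive_powR_expN x t : 0 < t ->
  is_derive t 1 (fun t => t `^ x * expR (- t))
    (x * Gamma_integrand x t - Gamma_integrand (x + 1) t).
Proof.
move=> t0; rewrite /Gamma_integrand addrK.
have h1 : is_derive t 1 (@powR R ^~ x) (x * t `^ (x - 1)) by exact:
  is_derive1_powR.
have h2 : is_derive t 1 (expR \o -%R) (expR (- t) * -1).
  by apply: is_derive1_comp.
apply: (is_derive_eq (is_deriveM h1 h2)).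
rewrite /GRing.scale/=; ring.
Qed.

Lemma Gamma_integrand_continuous x t : 0 < t ->
  {for t, continuous (Gamma_integrand x)}.
Proof.
by move=> t0; apply: (is_derive1_continuous (is_derive_powR_expN (x - 1) t0)).
Qed.

Lemma cvg_powR_expN0 x : 0 < x ->
  (n.+1%:R^-1 `^ x * expR (- n.+1%:R^-1)) @[n --> \oo] --> (0 : R).
Proof.
move=> x0; rewrite -(mul0r (expR 0)); apply: cvgM.
  apply: (cvg_comp (@harmonic R) (fun y : R => y `^ x)); last exact: powR_cvg0.
  move=> P P0; have : \forall n \near \oo, 0 < @harmonic R n -> P (harmonic n).
    exact: (@cvg_harmonic R _ P0).
  by apply: filterS => n; apply; exact: harmonic_gt0.
apply: (cvg_comp (fun n => - (n.+1%:R^-1 : R)) (@expR R));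
  last exact: (@continuous_expR R 0).
by rewrite -oppr0; apply: cvgN; exact: cvg_harmonic.
Qed.

(** With n the integer part of x, exp t >= t^(n+2) / (n+2)! >= t^x t / (n+2)!. *)
Lemma powR_expN_bound x t : 0 < x -> 1 <= t ->
  t `^ x * expR (- t) <= (Num.truncn x).+2`!%:R / t.
Proof.
move=> x0 t1; have t0 : 0 < t by apply: lt_le_trans t1.
set n := Num.truncn x.
rewrite ler_pdivlMr// expRN mulrAC ler_pdivrMr ?expR_gt0//.
apply: (@le_trans _ _ (t ^+ n.+2)).
  rewrite exprSr ler_wpM2r ?(ltW t0)// -powR_mulrn ?(ltW t0)// ler_powR//.
  exact/ltW/truncnS_gt.
rewrite mulrC -ler_pdivrMr ?ltr0n ?fact_gt0//.
by apply: le_trans (@expR_ge1Dxn R t n.+1 (ltW t0)); rewrite lerDr.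
Qed.

Lemma cvg_powR_expNy x : 0 < x ->
  (n.+2%:R `^ x * expR (- n.+2%:R)) @[n --> \oo] --> (0 : R).
Proof.
move=> x0.
apply: (@squeeze_cvgr _ _ _ _ (fun=> 0) (fun n => (Num.truncn x).+2`!%:R *
  (@harmonic R n.+1))).
- apply: nearW => n; rewrite mulr_ge0 ?powR_ge0 ?expR_ge0//=.
  by apply: powR_expN_bound => //; rewrite ler1n.
- exact: cvg_cst.
- rewrite -(mulr0 (Num.truncn x).+2`!%:R); apply: cvgM; first exact: cvg_cst.
  by rewrite (cvg_shiftS (@harmonic R)); exact: cvg_harmonic.
Qed.

Let lower_bounds_nonincreasing : nonincreasing_seq (fun n => n.+1%:R^-1 : R).
Proof. by apply/nonincreasing_seqP => n; rewrite lef_pV2 ?posrE// ler_nat. Qed.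

Let upper_bounds_nondecreasing : nondecreasing_seq (fun n => n.+2%:R : R).
Proof. by apply/nondecreasing_seqP => n; rewrite ler_nat. Qed.

Lemma eGamma_exhaust x :
  (\int[mu]_(t in `[(n.+1%:R^-1)%R, (n.+2%:R)%R]) (Gamma_integrand x t)%:E)%E
    @[n --> \oo] --> eGamma x.
Proof.
apply: (exhaust_integral lower_bounds_nonincreasing upper_bounds_nondecreasing
  bigcup_itv_pos) => t.
  by move=> _; exact: Gamma_integrand_ge0.
by move=> /itv_pos; exact: Gamma_integrand_continuous.
Qed.

(** Integration by parts on [1/(n+1), n+2]; the boundary terms t^x exp (- t) vanish
in the limit at both ends. *)
Lemma eGamma_recurrence x : 0 < x -> eGamma (x + 1) = (x%:E * eGamma x)%E.
Proof.
move=> x0.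
have h1 := @eGamma_exhaust (x + 1).
have h2 : (x%:E * (\int[mu]_(t in `[(n.+1%:R^-1)%R, (n.+2%:R)%R])
  (Gamma_integrand x t)%:E))%E @[n --> \oo] --> (x%:E * eGamma x)%E.
  by apply: cvgeZl => //; exact: eGamma_exhaust.
have h3 : ((n.+2%:R `^ x * expR (- n.+2%:R) - n.+1%:R^-1 `^ x * expR
  (- n.+1%:R^-1))%:E
  + (\int[mu]_(t in `[(n.+1%:R^-1)%R, (n.+2%:R)%R])
    (Gamma_integrand (x + 1) t)%:E))%E @[n --> \oo] --> eGamma (x + 1).
  rewrite -[X in _ --> X]add0e; apply: cvgeD.
  - by [].
  - apply: cvg_EFin; first exact: nearW.
    rewrite -(subrr (0 : R)); apply: cvgB; first exact: cvg_powR_expNy.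
    exact: cvg_powR_expN0.
  - exact: h1.
apply: (cvg_unique _ h3) => //.
rewrite (_ : (fun n => _) = fun n =>
  (x%:E * (\int[mu]_(t in `[(n.+1%:R^-1)%R, (n.+2%:R)%R])
  (Gamma_integrand x t)%:E))%E)//.
apply/funext => n.
have ab : n.+1%:R^-1 < n.+2%:R :> R.
  by rewrite (@le_lt_trans _ _ 1)// ?invf_le1// ?ler1n// ltr1n.
have ap : 0 < n.+1%:R^-1 :> R by rewrite invr_gt0.
have E : (\int[mu]_(t in `[(n.+1%:R^-1)%R, (n.+2%:R)%R])
  (x * Gamma_integrand x t - Gamma_integrand (x + 1)%R t)%:E)%E =
    (n.+2%:R `^ x * expR (- n.+2%:R) - n.+1%:R^-1 `^ x * expR
      (- n.+1%:R^-1))%:E.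
apply: (@is_derive_FTC2 R (fun t => t `^ x * expR (- t))) => //.
- move=> t /andP[at_ _]; apply: is_derive_powR_expN; exact: lt_le_trans at_.
- move=> t /andP[at_ _]; apply: cvgB.
    apply: cvgM; first exact: cvg_cst.
    by apply: Gamma_integrand_continuous; exact: lt_le_trans at_.
  by apply: Gamma_integrand_continuous; exact: lt_le_trans at_.
rewrite -E.
have ig y : mu.-integrable `[(n.+1%:R^-1 : R), n.+2%:R]
  (EFin \o Gamma_integrand y).
  apply: continuous_compact_integrable; first exact: segment_compact.
  apply: continuous_in_within => t /=; rewrite in_itv/= => /andP[at_ _].
  by apply: Gamma_integrand_continuous; exact: lt_le_trans at_.
under eq_integral do rewrite EFinB EFinM.
rewrite integralB//=; last 2 first.
- by apply: integrableZl => //; exact: ig.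
- exact: ig.
rewrite integralZl//; last exact: ig.
by rewrite subeK// integrable_fin_num//; exact: ig.
Qed.

Lemma eGamma1 : eGamma 1 = 1%:E.
Proof.
have -> : eGamma 1 = (\int[mu]_(t in `]0%R, +oo[) (expR (- t))%:E)%E.
  by apply: eq_integral => t _; rewrite /Gamma_integrand subrr powRr0 mul1r.
have cN (t : R) : is_derive t 1 (expR \o -%R) (expR (- t) * -1) by apply:
  is_derive1_comp.
have -> : 1%:E = (0 - (- 1))%:E :> \bar R by rewrite sub0r opprK.
apply: (ge0_FTC2_exhaust lower_bounds_nonincreasing upper_bounds_nondecreasing
  bigcup_itv_pos (F := fun t => - expR (- t))).
- by move=> n; rewrite (@le_lt_trans _ _ 1)// ?invf_le1 ?ler1n ?ltr1n.
- by move=> t _; exact: expR_ge0.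
- by move=> t _; exact: (is_derive1_continuous (cN t)).
- move=> t _; apply: (is_derive_eq (is_deriveN (cN t))).
  by rewrite mulrN1 opprK.
- apply: cvgN; rewrite -[X in _ --> X]expR0.
  apply: (cvg_comp (fun n => - (n.+1%:R^-1 : R)) (@expR R));
    last exact: (@continuous_expR R 0).
  by rewrite -oppr0; apply: cvgN; exact: cvg_harmonic.
- rewrite -oppr0; apply: cvgN.
  have := @cvgn_expR R; rewrite -(cvg_shiftS (fun n => expR (- n%:R))).
  by rewrite -(cvg_shiftS (fun n => expR (- n.+1%:R))).
Qed.

Lemma measurable_Gamma_integrand x :
  measurable_fun (`]0, +oo[%classic : set R) (Gamma_integrand x).
Proof.
by apply: in_continuous_measurable => // t /itv_pos; exact: Gamma_integrand_continuous.
Qed.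

Lemma eGamma_ge0 x : (0 <= eGamma x)%E.
Proof. by apply: integral_ge0 => t _; rewrite lee_fin. Qed.

Lemma eGamma_nat n : eGamma n.+1%:R = (n`!%:R)%:E.
Proof.
elim: n => [|n IH]; first by rewrite fact0 eGamma1.
by rewrite -natr1 eGamma_recurrence// IH -EFinM -natrM factS.
Qed.

(** From 1 on, t^(x-1) is at most 1 for t <= 1 and at most a natural power for
t > 1, so the integral is dominated by two factorials. The functional equation
extends this to 0 < x < 1. *)
Lemma eGamma_fin x : 0 < x -> eGamma x \is a fin_num.
Proof.
have H y : 1 <= y -> eGamma y \is a fin_num.
  move=> y1; set n := Num.truncn y.
  have : (eGamma y <= eGamma 1 + eGamma n.+2%:R)%E.
    rewrite /eGamma -ge0_integralD//=; last 4 first.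
    - by move=> t _; rewrite lee_fin.
    - by apply/measurable_EFinP; exact: measurable_Gamma_integrand.
    - by move=> t _; rewrite lee_fin.
    - by apply/measurable_EFinP; exact: measurable_Gamma_integrand.
    apply: ge0_le_integral => //=.
    - by move=> t _; rewrite lee_fin.
    - by apply/measurable_EFinP; exact: measurable_Gamma_integrand.
    - by apply/measurable_EFinP; apply: measurable_funD;
      exact: measurable_Gamma_integrand.
    move=> t /itv_pos t0;
      rewrite -EFinD lee_fin /Gamma_integrand -mulrDl ler_wpM2r ?expR_ge0//.
    rewrite subrr powRr0; have [t1|t1] := leP t 1.
      apply: (@le_trans _ _ (t `^ 0)); last by rewrite powRr0 lerDl powR_ge0.
      by apply: ger_powR; rewrite ?t0 ?subr_ge0.
    apply: (@le_trans _ _ (t `^ (n.+2%:R - 1))); last by rewrite lerDr.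
    rewrite ler_powR ?(ltW t1)// lerB// (le_trans (ltW (truncnS_gt _)))//.
    by rewrite ler_nat.
  rewrite eGamma1 eGamma_nat -EFinD => h.
  by rewrite ge0_fin_numE ?eGamma_ge0// (le_lt_trans h)// ltry.
move=> x0; have [/H//|x1] := leP 1 x.
have := H (x + 1); rewrite lerDr => /(_ (ltW x0)).
rewrite eGamma_recurrence//; have := eGamma_ge0 x; case: (eGamma x) => // _.
by rewrite mulry gtr0_sg// mul1e.
Qed.

Lemma EFin_Gamma x : 0 < x -> (Gamma x)%:E = eGamma x.
Proof. by move=> x0; rewrite fineK// eGamma_fin. Qed.

Lemma Gamma1 : Gamma (1 : R) = 1.
Proof. by apply: EFin_inj; rewrite EFin_Gamma// eGamma1. Qed.

Lemma GammaD1 x : 0 < x -> Gamma (x + 1) = x * Gamma x.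
Proof.
move=> x0; apply: EFin_inj.
by rewrite EFinM !EFin_Gamma ?addr_gt0// eGamma_recurrence.
Qed.

(** The graph of the concave function u^s lies below its tangent at u = 1. With
L = ln u, this is a combination of exp ((1 - s) L) >= 1 + (1 - s) L and
exp (- s L) >= 1 - s L. *)
Lemma powR_le_tangent (u s : R) : 0 < u -> 0 <= s <= 1 ->
  u `^ s <= 1 - s + s * u.
Proof.
move=> u0 /andP[s0 s1]; rewrite /powR gt_eqF//.
set L := ln u; set c := expR (s * L).
have c0 : 0 < c by exact: expR_gt0.
have h1 : c * (1 + (1 - s) * L) <= u.
  have -> : u = c * expR ((1 - s) * L).
    by rewrite -expRD -mulrDl addrC subrK mul1r lnK.
  by rewrite ler_pM2l// expR_ge1Dx.
have h2 : c * (1 - s * L) <= 1.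
  rewrite [leRHS](_ : _ = c * expR (- (s * L)));
    last by rewrite -expRD subrr expR0.
  by rewrite ler_pM2l// expR_ge1Dx.
have h3 := ler_wpM2l s0 h1.
have h4 : (1 - s) * (c * (1 - s * L)) <= (1 - s) * 1 by rewrite ler_wpM2l//
  subr_ge0.
have := lerD h4 h3; congr (_ <= _); ring.
Qed.

(** The instance of log-convexity from which the growth of Gamma is derived. The
tangent inequality at t / x bounds t^s by x^s (1 - s + s t / x); integrating, the
factor t turns Gamma x into Gamma (x + 1) = x Gamma x and the bracket sums
to 1. *)
Lemma Gamma_logconvex x s : 0 < x -> 0 <= s <= 1 ->
  Gamma (x + s) <= x `^ s * Gamma x.
Proof.
move=> x0 s01; have /andP[s0 s1] := s01.
have xs0 : 0 < x + s by rewrite ltr_wpDr.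
rewrite -lee_fin EFin_Gamma//.
have -> : x `^ s * Gamma x = x `^ s * (1 - s) * Gamma x + x `^ s * s / x *
  Gamma (x + 1).
  by rewrite GammaD1//; field; rewrite gt_eqF.
have c1 : 0 <= x `^ s * (1 - s) by rewrite mulr_ge0 ?powR_ge0// subr_ge0.
have c2 : 0 <= x `^ s * s / x by rewrite divr_ge0 ?(ltW x0)// mulr_ge0
  ?powR_ge0.
set c := x `^ s * (1 - s) in c1 *; set d := x `^ s * s / x in c2 *.
rewrite EFinD !EFinM !EFin_Gamma ?addr_gt0//.
have mg y : measurable_fun (`]0, +oo[%classic : set R) (fun t =>
  (Gamma_integrand y t)%:E).
  by apply/measurable_EFinP; exact: measurable_Gamma_integrand.
have gg y t : (0 <= (Gamma_integrand y t)%:E)%E by rewrite lee_fin.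
rewrite /eGamma -(ge0_integralZl mu (measurable_itv _) (mg _) (fun t _ =>
  gg _ t) (_ : (0 <= c%:E)%E))//.
rewrite -(ge0_integralZl mu (measurable_itv _) (mg _) (fun t _ => gg _ t)
  (_ : (0 <= d%:E)%E))//.
rewrite -ge0_integralD//=; last 4 first.
- by move=> t _; rewrite mule_ge0// lee_fin.
- by apply: measurable_funeM; apply/measurable_EFinP;
  exact: measurable_Gamma_integrand.
- by move=> t _; rewrite mule_ge0// lee_fin.
- by apply: measurable_funeM; apply/measurable_EFinP;
  exact: measurable_Gamma_integrand.
apply: ge0_le_integral => //=.
- by apply/measurable_EFinP; exact: measurable_Gamma_integrand.
- by apply: emeasurable_funD; apply: measurable_funeM; apply/measurable_EFinP;
  exact: measurable_Gamma_integrand.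
move=> t /itv_pos t0; rewrite -!EFinM -EFinD lee_fin /Gamma_integrand.
have -> : t `^ (x + s - 1) = t `^ (x - 1) * t `^ s.
  by rewrite -powRD ?(gt_eqF t0) ?implybT//; congr (_ `^ _); ring.
have -> : t `^ (x + 1 - 1) = t `^ (x - 1) * t.
  by rewrite mulrC mulr_powRB1 ?(ltW t0)// addrK.
have -> : t `^ s = x `^ s * (t / x) `^ s.
  by rewrite -powRM ?divr_ge0 ?(ltW x0) ?(ltW t0)// mulrC divfK// gt_eqF.
have := @powR_le_tangent (t / x) s (divr_gt0 t0 x0) s01.
have : 0 <= t `^ (x - 1) * expR (- t) * x `^ s.
  by rewrite mulr_ge0 ?powR_ge0// mulr_ge0 ?powR_ge0 ?expR_ge0.
move=> h /(ler_wpM2l h).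
rewrite /c /d.
by congr (_ <= _); field; rewrite ?gt_eqF.
Qed.

(** On ]0, 1], log-convexity gives 1 = Gamma (x + (1 - x)) <= x^(1-x) Gamma x. *)
Lemma Gamma_gt0 x : 0 < x -> 0 < Gamma x.
Proof.
have [n xn x0] : exists n, x <= n.+1%:R.
  by exists (Num.truncn x); exact/ltW/truncnS_gt.
elim: n x xn x0 => [|n IH] x xn x0.
  have s01 : 0 <= 1 - x <= 1 by rewrite subr_ge0 xn lerBlDr lerDl ltW.
  have := Gamma_logconvex x0 s01; rewrite addrC subrK Gamma1.
  move=> /(lt_le_trans (@ltr01 R)); rewrite pmulr_rgt0// powR_gt0//.
have [x1|x1] := leP x 1.
  by apply: IH => //; rewrite (le_trans x1)// ler1n.
rewrite -(subrK 1 x) GammaD1 ?subr_gt0// mulr_gt0 ?subr_gt0//.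
by apply: IH; rewrite ?subr_gt0// lerBlDr natr1.
Qed.

End Gamma.

(** * Quotients of Gamma values and Wallis products *)

Section GammaProducts.
Context {R : realType}.
Implicit Types (x y s a p q : R).

Lemma cvg_nat_ratio p q : 0 < q ->
  (n%:R + p) / (n%:R + q) @[n --> \oo] --> (1 : R).
Proof.
move=> q0.
have h : (n%:R + q)^-1 @[n --> \oo] --> (0 : R).
  apply/gtr0_cvgV0; first by apply: nearW => n; rewrite ltr_wpDl.
  apply: (cvg_comp (fun n => n%:R : R) (fun r => r + q)); first exact: cvgr_idn.
  exact: cvg_addrr.
rewrite (_ : (fun n => _) = fun n => 1 + (p - q) * (n%:R + q)^-1); last first.
  apply/funext => n; field.
  by rewrite gt_eqF// ltr_wpDl.
rewrite -[X in _ --> X]addr0; apply: cvgD; first exact: cvg_cst.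
rewrite -(mulr0 (p - q)); apply: cvgM => //; exact: cvg_cst.
Qed.

Lemma GammaDn x n : 0 < x ->
  Gamma (x + n%:R) = Gamma x * \prod_(i < n) (x + i%:R).
Proof.
move=> x0; elim: n => [|n IH]; first by rewrite big_ord0 addr0 mulr1.
rewrite -natr1 addrA GammaD1 ?ltr_wpDr// IH big_ord_recr/=.
by rewrite mulrC mulrA.
Qed.

Definition Gamma_ratio s x : R := Gamma (x + s) / Gamma x.

Lemma Gamma_ratio_gt0 s x : 0 < x -> 0 <= s -> 0 < Gamma_ratio s x.
Proof. by move=> x0 s0; rewrite divr_gt0 ?Gamma_gt0// ltr_wpDr. Qed.

Lemma Gamma_ratio_le s x : 0 < x -> 0 <= s <= 1 -> Gamma_ratio s x <= x `^ s.
Proof. by move=> x0 s01; rewrite ler_pdivrMr ?Gamma_gt0// Gamma_logconvex. Qed.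

(** Log-convexity again, at x + s and with the exponent 1 - s:
x Gamma x = Gamma ((x + s) + (1 - s)). *)
Lemma Gamma_ratio_ge s x : 0 < x -> 0 <= s <= 1 ->
  x `^ s * (x / (x + s)) <= Gamma_ratio s x.
Proof.
move=> x0 s01; have /andP[s0 s1] := s01.
have xs0 : 0 < x + s by rewrite ltr_wpDr.
rewrite ler_pdivlMr ?Gamma_gt0//.
have h : x * Gamma x <= (x + s) `^ (1 - s) * Gamma (x + s).
  rewrite -GammaD1// [in leLHS](_ : x + 1 = (x + s) + (1 - s)); last by ring.
  by apply: Gamma_logconvex => //; rewrite subr_ge0 s1 lerBlDr lerDl.
apply: (@le_trans _ _
  (x `^ s / (x + s) * ((x + s) `^ (1 - s) * Gamma (x + s)))).
  rewrite -!mulrA ler_wpM2l ?powR_ge0// mulrCA ler_wpM2l//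
    ?invr_ge0 ?(ltW xs0)//.
rewrite mulrA ler_piMl ?(ltW (Gamma_gt0 _))//.
rewrite mulrAC ler_pdivrMr// mul1r.
apply: (@le_trans _ _ ((x + s) `^ s * (x + s) `^ (1 - s))).
  by rewrite ler_wpM2r ?powR_ge0// ge0_ler_powR ?nnegrE ?(ltW x0) ?(ltW xs0)//
    lerDl.
by rewrite -powRD ?(gt_eqF xs0) ?implybT// [s + _]addrC subrK powRr1// ltW.
Qed.

(** Gamma_ratio s behaves like the s-th power, up to the factor x / (x + s). *)
Lemma Gamma_ratio_quotient_bounds s x y : 0 < y -> 0 < x -> 0 <= s <= 1 ->
  (x / y) `^ s * (x / (x + s)) <= Gamma_ratio s x / Gamma_ratio s y
  <= (x / y) `^ s * ((y + s) / y).
Proof.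
move=> y0 x0 s01; have /andP[s0 s1] := s01.
have ry := Gamma_ratio_gt0 y0 s0.
have ys : 0 < y `^ s by rewrite powR_gt0.
have xs : 0 < x `^ s by rewrite powR_gt0.
have ysp : 0 < y + s by rewrite ltr_wpDr.
have e : (x / y) `^ s = x `^ s / y `^ s.
  have -> : x `^ s = (x / y) `^ s * y `^ s.
    by rewrite -powRM ?divr_ge0 ?(ltW x0) ?(ltW y0)// divfK// gt_eqF.
  by rewrite mulfK// gt_eqF.
rewrite e; apply/andP; split.
  rewrite ler_pdivlMr//; apply: le_trans (Gamma_ratio_ge x0 s01).
  rewrite mulrAC ler_wpM2r ?divr_ge0 ?(ltW x0) ?addr_ge0 ?(ltW x0)//.
  rewrite -mulrA ler_piMr ?(ltW xs)//.
  by rewrite mulrC ler_pdivrMr// mul1r Gamma_ratio_le.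
rewrite ler_pdivrMr//; apply: (le_trans (Gamma_ratio_le x0 s01)).
have c0 : 0 <= (y + s) / y / y `^ s by rewrite ltW ?divr_gt0.
have h := ler_wpM2l c0 (Gamma_ratio_ge y0 s01).
have e1 : (y + s) / y / y `^ s * (y `^ s * (y / (y + s))) = 1.
  by field; rewrite !gt_eqF.
rewrite e1 in h.
have -> : x `^ s / y `^ s * ((y + s) / y) * Gamma_ratio s y =
  x `^ s * ((y + s) / y / y `^ s * Gamma_ratio s y) by ring.
by rewrite ler_peMr ?(ltW xs).
Qed.

Lemma Gamma_ratio_quotient_cvg1 s x y : 0 < y -> y <= x -> 0 <= s <= 1 ->
  Gamma_ratio s (x + n%:R) / Gamma_ratio s (y + n%:R) @[n --> \oo] --> (1 : R).
Proof.
move=> y0 yx s01; have /andP[s0 s1] := s01.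
have x0 : 0 < x by apply: lt_le_trans yx.
apply: (@squeeze_cvgr _ _ _ _ (fun n => (n%:R + x) / (n%:R + (x + s)))
  (fun n => ((n%:R + x) / (n%:R + y)) * ((n%:R + (y + s)) / (n%:R + y)))).
- apply: nearW => n.
  have xn : 0 < x + n%:R by rewrite ltr_wpDr.
  have yn : 0 < y + n%:R by rewrite ltr_wpDr.
  have /andP[h1 h2] := Gamma_ratio_quotient_bounds yn xn s01.
  have q1 : 1 <= (x + n%:R) / (y + n%:R) by rewrite ler_pdivlMr// mul1r lerD2r.
  rewrite !(addrC n%:R); apply/andP; split.
    apply: le_trans h1; rewrite addrAC ler_peMl ?divr_ge0 ?addr_ge0 ?(ltW x0)//.
    by have := ler_powR q1 s0; rewrite powRr0.
  apply: (le_trans h2);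
    rewrite [y + s + _]addrAC ler_wpM2r ?divr_ge0 ?addr_ge0 ?(ltW y0)//.
  exact: ler1_powR.
- by apply: cvg_nat_ratio; rewrite ltr_wpDr.
- by rewrite -[X in _ --> X]mulr1; apply: cvgM; exact: cvg_nat_ratio.
Qed.

(** The source of the factor 4^a: doubling the argument of a function equivalent to
x^s multiplies it by 2^s. *)
Lemma Gamma_ratio_quotient_cvg2 s : 0 <= s <= 1 ->
  Gamma_ratio s (1 + n.*2%:R) / Gamma_ratio s (1 + n%:R) @[n --> \oo] -->
    (2 : R) `^ s.
Proof.
move=> s01; have /andP[s0 s1] := s01.
pose l n : R := (n%:R + 2^-1) / (n%:R + 1).
pose l' n : R := (n%:R + 2^-1) / (n%:R + (2^-1 + s / 2)).
pose u n : R := (n%:R + (1 + s)) / (n%:R + 1).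
apply: (@squeeze_cvgr _ _ _ _ (fun n => 2 `^ s * l n * l' n) (fun n =>
  2 `^ s * u n)).
- apply: nearW => n.
  have xn : 0 < 1 + n.*2%:R :> R by rewrite ltr_wpDr.
  have yn : 0 < 1 + n%:R :> R by rewrite ltr_wpDr.
  have /andP[h1 h2] := Gamma_ratio_quotient_bounds yn xn s01.
  have l0 : 0 < l n by rewrite /l divr_gt0// ltr_wpDl.
  have l1 : l n <= 1 by rewrite /l ler_pdivrMr ?ltr_wpDl// mul1r lerD2l; lra.
  have e : (1 + n.*2%:R) / (1 + n%:R) = 2 * l n.
    rewrite /l -muln2 natrM; field.
    by rewrite addrC gt_eqF.
  rewrite e powRM ?(ltW l0)// in h1 h2.
  apply/andP; split.
    apply: le_trans h1; apply: ler_pM.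
    - by rewrite mulr_ge0 ?powR_ge0 ?(ltW l0).
    - by rewrite divr_ge0 ?addr_ge0 ?divr_ge0.
    - rewrite ler_wpM2l ?powR_ge0//; apply: ger1_powR => //.
      by rewrite l0.
    - rewrite le_eqVlt; apply/orP; left; apply/eqP.
      have p1 : n%:R + (2^-1 + s / 2) != 0 :> R by rewrite gt_eqF// ltr_wpDl//
        ltr_wpDr// divr_ge0.
      have p2 : 1 + n.*2%:R + s != 0 :> R by rewrite gt_eqF// ltr_wpDr.
      rewrite /l'; move: p1 p2; rewrite -muln2 natrM => p1 p2; field.
      have n0 : 0 <= n%:R :> R by [].
      by do ?[apply/andP; split]; rewrite gt_eqF//; lra.
  apply: (le_trans h2); rewrite /u [_ + (1 + s)]addrC [n%:R + 1]addrC addrAC.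
  rewrite ler_wpM2r ?divr_ge0 ?addr_ge0//.
  rewrite ler_piMr ?powR_ge0//.
  have := @ger_powR R (l n); rewrite l0 l1 => /(_ isT) h.
  by have := h _ _ s0; rewrite powRr0.
- rewrite -[X in _ --> X]mulr1; apply: cvgM.
    rewrite -[X in _ --> X]mulr1; apply: cvgM; first exact: cvg_cst.
    exact: cvg_nat_ratio.
  by apply: cvg_nat_ratio; rewrite ltr_wpDr// divr_ge0.
- rewrite -[X in _ --> X]mulr1; apply: cvgM; first exact: cvg_cst.
  exact: cvg_nat_ratio.
Qed.

(** The quotient of the first n factors relating cos_int 0 to cos_int (2 n) by those
relating cos_int (2 a) to cos_int (2 a + 2 n). *)
Definition wallis a n : R :=
  \prod_(i < n) ((2^-1 + i%:R) * (1 + a + i%:R) /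
    ((1 + i%:R) * (2^-1 + a + i%:R))).

Lemma wallisS a n : wallis a n.+1 =
  wallis a n * ((2^-1 + n%:R) * (1 + a + n%:R) /
    ((1 + n%:R) * (2^-1 + a + n%:R))).
Proof. by rewrite /wallis big_ord_recr. Qed.

Definition wallis_lim a : R :=
  Gamma (2^-1 + a) / (Gamma (2^-1 : R) * Gamma (1 + a)).

Lemma wallis_cvg a : 0 <= a <= 1 -> wallis a n @[n --> \oo] --> wallis_lim a.
Proof.
move=> a01; have /andP[a0 a1] := a01.
have h2 : 0 < 2^-1 :> R by rewrite invr_gt0.
have h21 : 2^-1 <= 1 :> R by rewrite invf_le1// ler1n.
rewrite (_ : wallis a = fun n => wallis_lim a *
    (Gamma_ratio a (1 + n%:R) / Gamma_ratio a (2^-1 + n%:R))).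
  rewrite -[X in _ --> X]mulr1; apply: cvgM; first exact: cvg_cst.
  exact: Gamma_ratio_quotient_cvg1.
apply/funext => n; rewrite /Gamma_ratio ![_ + n%:R + a]addrAC !GammaDn
  ?ltr_wpDr//.
rewrite Gamma1 /wallis_lim /wallis.
rewrite big_split/= prodfV !big_split/=.
have p x : 0 < x -> \prod_(i < n) (x + i%:R) != 0.
  by move=> x0; apply/prodf_neq0 => i _; rewrite gt_eqF// ltr_wpDr.
have p1 := p _ (@ltr01 R); have p2 := p _ h2.
have p3 : \prod_(i < n) (2^-1 + a + i%:R) != 0 by apply: p; rewrite ltr_wpDr.
have p4 : \prod_(i < n) (1 + a + i%:R) != 0 by apply: p; rewrite ltr_wpDr.
have g1 : Gamma (2^-1 : R) != 0 by rewrite gt_eqF// Gamma_gt0.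
have g2 : Gamma (2^-1 + a) != 0 by rewrite gt_eqF// Gamma_gt0// ltr_wpDr.
have g3 : Gamma (1 + a) != 0 by rewrite gt_eqF// Gamma_gt0// ltr_wpDr.
move: p1 p2 p3 p4 g1 g2 g3.
move: (\prod_(i < n) _) (\prod_(i < n) _) (\prod_(i < n) _) (\prod_(i < n) _)
  (Gamma _) (Gamma _) (Gamma _).
move=> A B C D E F G *; field.
by do ?[apply/andP; split].
Qed.

Definition rising_ratio a n : R := \prod_(i < n) ((1 + a + i%:R) / (1 + i%:R)).

Lemma rising_ratioS a n : rising_ratio a n.+1 =
  rising_ratio a n * ((1 + a + n%:R) / (1 + n%:R)).
Proof. by rewrite /rising_ratio big_ord_recr. Qed.

Lemma rising_ratio_gt0 a n : 0 <= a -> 0 < rising_ratio a n.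
Proof. by move=> a0; apply: prodr_gt0 => i _;
  rewrite divr_gt0// ltr_wpDr// ltr_wpDr. Qed.

Lemma rising_ratioE a n : 0 <= a ->
  rising_ratio a n = Gamma_ratio a (1 + n%:R) / Gamma (1 + a).
Proof.
move=> a0; rewrite /Gamma_ratio [_ + n%:R + a]addrAC !GammaDn ?ltr_wpDr//
  Gamma1 mul1r.
rewrite /rising_ratio big_split/= prodfV [Gamma _ * _]mulrC [RHS]mulrAC mulfK//.
by rewrite gt_eqF// Gamma_gt0// ltr_wpDr.
Qed.

(** The duplication of the argument in Gamma (1 + 2 a), at the level of finite
products: among the factors k (k + 2 a), those with k = 2 j and k = 2 j - 1 are
four times j (j + a) and (j - 1/2) (j - 1/2 + a). *)
Lemma gauss_wallis a n : 0 <= a ->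
  \prod_(i < n.*2) ((i.+1%:R + a) ^+ 2 / (i.+1%:R * (i.+1%:R + 2 * a))) *
    rising_ratio a n ^+ 2 =
  wallis a n * rising_ratio a n.*2 ^+ 2.
Proof.
move=> a0; elim: n => [|n IH].
  by rewrite /wallis /rising_ratio !big_ord0.
rewrite doubleS wallisS !rising_ratioS 2!big_ord_recr/=.
set G := \prod_(i < n.*2) _ in IH *.
have -> : G = wallis a n * rising_ratio a n.*2 ^+ 2 / rising_ratio a n ^+ 2.
  by rewrite -IH mulfK// expf_neq0// gt_eqF// rising_ratio_gt0.
have q : rising_ratio a n != 0 by rewrite gt_eqF// rising_ratio_gt0.
have n0 : 0 <= n%:R :> R by [].
rewrite -!natr1 -muln2 natrM; field.
rewrite q.
by do ?[apply/andP; split] => //; rewrite gt_eqF//; lra.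
Qed.

Lemma gauss_sum_wallis a : 0 < a < 1 -> gauss_sum a 0 = 4 `^ a * wallis_lim a.
Proof.
move=> ha; have /andP[a0 a1] := ha.
have a01 : 0 <= a <= 1 by rewrite !ltW.
have h1 := gauss_sum_prod ha.
have h2 : \prod_(i < n.*2) ((i.+1%:R + a) ^+ 2 / (i.+1%:R * (i.+1%:R + 2 * a)))
  @[n --> \oo] --> gauss_sum a 0.
  move=> A /h1 [N _ hN]; exists N => // n /= Nn; apply: hN => /=.
  by rewrite (leq_trans Nn)// -addnn leq_addr.
have h3 : wallis a n * (Gamma_ratio a (1 + n.*2%:R) / Gamma_ratio a (1 + n%:R))
  ^+ 2 @[n --> \oo] --> wallis_lim a * (2 `^ a) ^+ 2.
  have h := Gamma_ratio_quotient_cvg2 a01.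
  by apply: cvgM; [exact: wallis_cvg|rewrite expr2; apply: cvgM].
have -> : 4 `^ a * wallis_lim a = wallis_lim a * (2 `^ a) ^+ 2.
  rewrite mulrC; congr (_ * _); rewrite expr2 -powRM//; congr (_ `^ _).
  by rewrite -natrM.
apply: (cvg_unique _ h2) => //.
rewrite (_ : (fun n => _) =
  (fun n => wallis a n * (Gamma_ratio a (1 + n.*2%:R) / Gamma_ratio a
  (1 + n%:R)) ^+ 2))//.
apply/funext => n.
have f0 : rising_ratio a n != 0 by rewrite gt_eqF// rising_ratio_gt0// ltW.
apply: (@mulIf _ (rising_ratio a n ^+ 2)); first by rewrite expf_neq0.
rewrite gauss_wallis ?(ltW a0)// -mulrA -exprMn !rising_ratioE ?(ltW a0)//.
congr (_ * _ ^+ 2).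
by rewrite mulrA divfK// gt_eqF// Gamma_ratio_gt0 ?(ltW a0)// ltr_wpDr.
Qed.

End GammaProducts.

(** * Integrals of powers of the cosine *)

Section CosIntegral.
Context {R : realType}.
Local Notation mu := (@lebesgue_measure R).
Implicit Types (x y s t a : R).

Lemma continuous_powR_max s : 0 <= s ->
  continuous (fun y : R => Num.max y 0 `^ s).
Proof.
rewrite le_eqVlt => /predU1P[<- y|s0 y].
  rewrite (_ : (fun y => _) = cst 1); first exact: cst_continuous.
  by apply/funext => z; rewrite powRr0.
(* at 0, the inequality y^s < e holds as soon as |y| < e^(1/s) *)
have [y0|y0|->] := ltgtP y 0.
- apply/cvgrPdist_lt => e e0; near=> z.
  have z0 : z < 0 by near: z; exact: lt_nbhsl.
  by rewrite !max_r ?ltW// subrr normr0.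
- have c : {for y, continuous (@powR R ^~ s)} by exact:
  (is_derive1_continuous (is_derive1_powR s y0)).
  have e : \forall z \near y, z `^ s = Num.max z 0 `^ s.
    by near=> z; rewrite max_l// ltW//; near: z; exact: lt_nbhsr.
  rewrite /continuous_at max_l ?ltW//; apply: cvg_trans c.
  by apply: near_eq_cvg.
- suff H : Num.max z 0 `^ s @[z --> (0 : R)] --> (0 : R).
    by rewrite /continuous_at maxxx powR0 ?gt_eqF.
  apply/cvgr0Pnorm_lt => e e0.
  have : \forall z \near (0 : R), `|z| < e `^ s^-1.
    by apply: nbhs0_lt; rewrite powR_gt0.
  apply: filterS => z ze; rewrite ger0_norm ?powR_ge0//.
  apply: (@le_lt_trans _ _ (`|z| `^ s)).
    by rewrite ge0_ler_powR ?nnegrE ?(ltW s0)// ?le_max ?lexx ?orbT// ge_max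
      ler_norm normr_ge0.
  have := gt0_ltr_powR s0; move=> /(_ _ _ _ _ ze);
    rewrite !nnegrE => /(_ (normr_ge0 _) (powR_ge0 _ _)).
  by rewrite -powRrM mulVf ?gt_eqF// powRr1// ltW.
Unshelve. all: by end_near. Qed.

(** The positive part makes this function continuous on the whole line for every
s >= 0: powR takes the value 1 at negative numbers. *)
Definition cos_pow s x : R := Num.max (cos x) 0 `^ s.

Lemma cos_pow_ge0 s x : 0 <= cos_pow s x. Proof. exact: powR_ge0. Qed.

Lemma continuous_cos_pow s : 0 <= s -> continuous (cos_pow s).
Proof.
move=> s0 x; apply: (@continuous_comp _ _ _ (@cos R) (fun y =>
  Num.max y 0 `^ s)).
  exact: continuous_cos.
exact: continuous_powR_max.
Qed.

Definition cos_int s : R := \int[mu]_(x in `[- (pi / 2), pi / 2]) cos_pow s x.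

Let pi2 : - (pi / 2) < pi / 2 :> R.
Proof. by rewrite gtrN// divr_gt0 ?pi_gt0. Qed.

Lemma cos_powZ_integrable k s (b c : R) : 0 <= s ->
  mu.-integrable `[b, c] (EFin \o (fun x => k * cos_pow s x)).
Proof.
move=> s0; apply: continuous_compact_integrable; first exact: segment_compact.
apply: continuous_in_within => x _; apply: cvgM; first exact: cvg_cst.
exact: continuous_cos_pow.
Qed.

Lemma cos_pow_integrable s (b c : R) : 0 <= s -> mu.-integrable `[b, c]
  (EFin \o cos_pow s).
Proof.
move=> s0; apply: continuous_compact_integrable; first exact: segment_compact.
by apply: continuous_in_within => x _; exact: continuous_cos_pow.
Qed.

Lemma is_derive_sin_cos_pow s x : 0 <= s -> - (pi / 2) < x < pi / 2 ->
  is_derive x 1 (fun x => sin x * cos_pow (s + 1) x)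
    ((s + 2) * cos_pow (s + 2) x - (s + 1) * cos_pow s x).
Proof.
move=> s0 hx; have c0 : 0 < cos x by exact: cos_gt0_pihalf.
have n : \forall z \near x, sin z * (cos z `^ (s + 1)) =
  sin z * cos_pow (s + 1) z.
  near=> z; rewrite /cos_pow max_l// ltW//; near: z.
  by apply: (@continuous_cos R x (fun y => 0 < y)); exact: lt_nbhsr.
apply: (near_eq_is_derive n).
have d1 : is_derive x 1 (@powR R ^~ (s + 1) \o cos)
  ((s + 1) * cos x `^ s * - sin x).
  by have := is_derive1_powR (s + 1) c0; rewrite addrK => ?;
    exact: is_derive1_comp.
apply: (is_derive_eq (is_deriveM (is_derive_sin x) d1)).
rewrite /cos_pow max_l ?(ltW c0)// /GRing.scale/=.
have -> : cos x `^ (s + 1) = cos x * cos x `^ s.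
  by rewrite powRD ?(gt_eqF c0) ?implybT// powRr1 ?(ltW c0)// mulrC.
have -> : cos x `^ (s + 2) = cos x ^+ 2 * cos x `^ s.
  by rewrite powRD ?(gt_eqF c0) ?implybT// powR_mulrn ?(ltW c0)// mulrC.
have -> : sin x * ((s + 1) * cos x `^ s * - sin x) =
  - sin x ^+ 2 * ((s + 1) * cos x `^ s) by ring.
rewrite sin2cos2; ring.
Unshelve. all: by end_near. Qed.

(** The function sin cos^(s+1) vanishes at both ends, and its derivative is
(s + 2) cos^(s+2) - (s + 1) cos^s. *)
Lemma cos_int_recurrence s : 0 <= s -> (s + 2) * cos_int (s + 2) =
  (s + 1) * cos_int s.
Proof.
move=> s0; have s1 : 0 <= s + 1 by rewrite addr_ge0.
have s2 : 0 <= s + 2 by rewrite addr_ge0.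
apply/eqP; rewrite -subr_eq0; apply/eqP.
rewrite /cos_int -!RintegralZl//; [|exact: cos_pow_integrable..].
rewrite -RintegralB//; last 2 first.
- exact: cos_powZ_integrable.
- exact: cos_powZ_integrable.
rewrite /Rintegral (@continuous_FTC2 _ _ (fun x => sin x * cos_pow (s + 1)
  x))//.
- have s1n : s + 1 != 0 by rewrite gt_eqF// ltr_wpDl.
  by rewrite /cos_pow cosN cos_pihalf maxxx powR0// !mulr0 -EFinB subrr.
- apply: continuous_in_within => x _; apply: cvgB;
  (apply: cvgM; first exact: cvg_cst);
    exact: continuous_cos_pow.
- have c : continuous (fun x => sin x * cos_pow (s + 1) x).
    by move=> x; apply: cvgM; [exact: continuous_sin|exact: continuous_cos_pow].
  split.
  + by move=> x; rewrite in_itv/= => /(is_derive_sin_cos_pow s0)[].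
  + exact/cvg_at_right_filter/c.
  + exact/cvg_at_left_filter/c.
- move=> x; rewrite in_itv/= => /(is_derive_sin_cos_pow s0)[_ <-].
  by rewrite derive1E.
Qed.

Lemma cos_int0 : cos_int 0 = pi.
Proof.
rewrite /cos_int (@eq_Rintegral _ _ _ _ _ (cst 1)); last by move=> x _;
  rewrite /cos_pow powRr0.
rewrite Rintegral_cst// mul1r.
have := @lebesgue_measure_itv R `[- (pi / 2), pi / 2].
by rewrite /= lte_fin pi2 => ->; rewrite -EFinD/= opprK -splitr.
Qed.

Lemma cos_int1 : cos_int 1 = 2.
Proof.
transitivity (\int[mu]_(x in `[- (pi / 2), pi / 2]) cos x).
  apply: eq_Rintegral => x; rewrite inE/= in_itv/= => hx.
  by rewrite /cos_pow max_l ?cos_ge0_pihalf// powRr1// cos_ge0_pihalf.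
rewrite /Rintegral (@is_derive_FTC2 _ sin)//.
- by rewrite /= sinN sin_pihalf opprK.
- by move=> x _; exact: continuous_cos.
Qed.

Lemma cos_int_anti s t : 0 <= s <= t -> cos_int t <= cos_int s.
Proof.
move=> /andP[s0 st]; have t0 := le_trans s0 st.
apply: le_Rintegral => //; [exact: cos_pow_integrable..|].
move=> x _; rewrite /cos_pow.
have [c0|c0] := leP (cos x) 0; last by apply: ger_powR; rewrite ?c0 ?cos_le1.
move: t0; rewrite le_eqVlt => /predU1P[t0|t0].
  by rewrite -t0 in st *; rewrite (_ : s = 0)//; apply/eqP; rewrite eq_le st s0.
by rewrite powR0 ?gt_eqF// powR_ge0.
Qed.

Lemma cos_int_prod s n : 0 <= s -> cos_int (2 * s + n.*2%:R) =
  cos_int (2 * s) * \prod_(i < n) ((2^-1 + s + i%:R) / (1 + s + i%:R)).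
Proof.
move=> s0; elim: n => [|n IH]; first by rewrite big_ord0 addr0 mulr1.
have n0 : 0 <= n%:R :> R by [].
have h0 : 0 <= 2 * s + n.*2%:R by rewrite addr_ge0// mulr_ge0.
rewrite big_ord_recr/= [RHS]mulrA -IH.
rewrite (_ : 2 * s + n.+1.*2%:R = 2 * s + n.*2%:R + 2); last first.
  by rewrite doubleS -[n.*2.+2]addn2 natrD addrA.
have := cos_int_recurrence h0.
have q : 2 * s + n.*2%:R + 2 != 0 by rewrite gt_eqF// ltr_wpDl.
move=> /(canRL (mulKf q)) ->; rewrite -muln2 natrM.
rewrite -muln2 natrM in q; field.
by rewrite ?q; do ?[apply/andP; split] => //; rewrite gt_eqF//; lra.
Qed.

(** Wallis's argument: the recurrence expresses cos_int (2 a) through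
cos_int (2 a + 2 n) and pi through cos_int (2 n); monotonicity squeezes
cos_int (2 a + 2 n) / cos_int (2 n) between (2 n + 1) / (2 n + 2) and 1. *)
Lemma cos_int_wallis a : 0 <= a <= 1 -> cos_int (2 * a) = pi * wallis_lim a.
Proof.
move=> a01; have /andP[a0 a1] := a01.
have pe (x : R) n : 0 < x -> 0 < \prod_(i < n) (x + i%:R).
  by move=> x0; apply: prodr_gt0 => i _; rewrite ltr_wpDr.
have h2 : 0 < 2^-1 :> R by rewrite invr_gt0.
have e0 n : cos_int (n.*2%:R) = pi * \prod_(i < n) ((2^-1 + i%:R) / (1 + i%:R)).
  have := @cos_int_prod 0 n (lexx _); rewrite mulr0 add0r cos_int0 => ->.
  by congr (_ * _); apply: eq_bigr => i _; rewrite !addr0.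
have p0 n : 0 < cos_int (n.*2%:R).
  rewrite e0 mulr_gt0 ?pi_gt0//; apply: prodr_gt0 => i _.
  by rewrite divr_gt0// ltr_wpDr.
have e n : cos_int (2 * a) =
  pi * (wallis a n * (cos_int (2 * a + n.*2%:R) / cos_int (n.*2%:R))).
  have P1 := pe _ n h2; have P2 := pe _ n (@ltr01 R).
  have P3 : 0 < \prod_(i < n) (2^-1 + a + i%:R) by apply: pe; rewrite ltr_wpDr.
  have P4 : 0 < \prod_(i < n) (1 + a + i%:R) by apply: pe; rewrite ltr_wpDr.
  rewrite cos_int_prod// e0 /wallis !big_split/= !prodfV !big_split/=.
  have := @pi_gt0 R.
  move: P1 P2 P3 P4.
  move: (\prod_(i < n) _) (\prod_(i < n) _) (\prod_(i < n) _) (\prod_(i < n) _)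
    (cos_int _) (@pi R).
  move=> A B C D E F *; field.
  by do ?[apply/andP; split]; rewrite gt_eqF.
have r n : (n%:R + 2^-1) / (n%:R + 1) <= cos_int (2 * a + n.*2%:R) / cos_int
  (n.*2%:R) <= 1.
  rewrite ler_pdivlMr// ler_pdivrMr// mul1r; apply/andP; split; last first.
    by apply: cos_int_anti; rewrite ler0n/= lerDr mulr_ge0.
  apply: (@le_trans _ _ (cos_int (n.*2%:R + 2))).
    have := @cos_int_recurrence n.*2%:R (ler0n _ _).
    have q : n.*2%:R + 2 != 0 :> R by rewrite gt_eqF// ltr_wpDl.
    move=> /(canRL (mulKf q)) ->; rewrite le_eqVlt; apply/orP; left; apply/eqP.
    have n0 : 0 <= n%:R :> R by [].
    rewrite -muln2 natrM in q *; move: (cos_int _) => C; field.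
    by rewrite ?q; do ?[apply/andP; split] => //; rewrite gt_eqF//; lra.
  apply: cos_int_anti; rewrite addr_ge0 ?mulr_ge0//= addrC lerD2l.
  by lra.
have l1 : pi * (wallis a n * (cos_int (2 * a + n.*2%:R) / cos_int (n.*2%:R)))
  @[n --> \oo] --> pi * wallis_lim a.
  apply: cvgM; first exact: cvg_cst.
  rewrite -[X in _ --> X]mulr1; apply: cvgM; first exact: wallis_cvg.
  apply: (@squeeze_cvgr _ _ _ _ (fun n => (n%:R + 2^-1) / (n%:R + 1))
    (fun=> 1)).
  - exact: nearW.
  - exact: cvg_nat_ratio.
  - exact: cvg_cst.
apply/esym/(cvg_unique _ l1) => //.
rewrite (_ : (fun n => _) = cst (cos_int (2 * a))); first exact: cvg_cst.
by apply/funext => n; rewrite -e.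
Qed.

(** The integral of cos is 2, and it is also pi wallis_lim (1/2), that is
pi / (Gamma (1/2) Gamma (3/2)) with Gamma (3/2) = Gamma (1/2) / 2. *)
Lemma Gamma_half : Gamma (2^-1 : R) = Num.sqrt pi.
Proof.
have h2 : 0 < 2^-1 :> R by rewrite invr_gt0.
have h : 0 <= (2^-1 : R) <= 1 by apply/andP; split; lra.
have := cos_int_wallis h; rewrite divff// cos_int1 /wallis_lim.
have g0 := @Gamma_gt0 R _ h2.
have -> : 2^-1 + 2^-1 = 1 :> R by field.
rewrite Gamma1 addrC GammaD1//; set G := Gamma _ => e.
have {}e : G ^+ 2 = pi.
  have g1 : G != 0 by rewrite gt_eqF.
  apply: (@mulfI _ 2) => //; rewrite [in LHS]e; field.
  exact: g1.
by rewrite -e sqrtr_sqr ger0_norm// ltW.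
Qed.

End CosIntegral.

(** * Area in slope coordinates *)

Section Slopes.
Context {R : realType}.
Local Notation mu := (@lebesgue_measure R).
Local Notation borelR := (measurableTypeR R).

Lemma lebesgue_measure_scale (k : R) (A : set R) : k != 0 -> measurable A ->
  mu A = (`|k|%:E * mu ((fun t => k * t)%R @^-1` A))%E.
Proof.
move=> k0 mA.
have mk : measurable_fun setT (fun t : borelR => (k * t)%R : borelR).
  exact: mulrl_measurable.
pose nu := mscale (NngNum (normr_ge0 k))
  (pushforward mu (fun t : borelR => (k * t)%R : borelR)).
suff H : forall X, ocitv X -> mu X = nu mk X.
  exact: (@lebesgue_measure_unique R (mscale (NngNum (normr_ge0 k))
    (pushforward mu (fun t : borelR => (k * t)%R : borelR))) H A mA).
move=> _ [[a b] _ <-].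
change (mu `]a, b]%classic =
  (`|k|%:E * mu ((fun t => k * t)%R @^-1` `]a, b]%classic))%E).
have [k1|k1] : 0 < k \/ k < 0 by case: (ltgtP k 0) k0 => //; [right|left].
- rewrite (_ : _ @^-1` _ = `](a / k)%R, (b / k)%R]%classic); last first.
    by apply/seteqP; split => x /=;
      rewrite !in_itv/= ltr_pdivrMr// ler_pdivlMr// (mulrC k).
  have := @lebesgue_measure_itv R `]a, b];
    have := @lebesgue_measure_itv R `](a / k)%R, (b / k)%R].
  rewrite /= !lte_fin => -> ->; rewrite ltr_pM2r ?invr_gt0//.
  case: ifP => ab; last by rewrite mule0.
  by rewrite -!EFinD -EFinM gtr0_norm// -mulrBl mulrC divfK.
- rewrite (_ : _ @^-1` _ = `[(b / k)%R, (a / k)%R[%classic); last first.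
    by apply/seteqP; split => x /=;
      rewrite !in_itv/= ltr_ndivlMr// ler_ndivrMr// (mulrC k) andbC.
  have := @lebesgue_measure_itv R `]a, b];
    have := @lebesgue_measure_itv R `[(b / k)%R, (a / k)%R[.
  rewrite /= !lte_fin => -> ->; rewrite ltr_nM2r ?invr_lt0//.
  case: ifP => ab; last by rewrite mule0.
  by rewrite -!EFinD -EFinM ltr0_norm// -mulrBl mulNr mulrC divfK// opprB.
Qed.

(** Polar coordinates with the slope as angular variable. On the vertical line above
x <> 0, the substitution y = x t scales lengths by |x|; Tonelli's theorem then
makes t the outer variable. The line above x = 0 is negligible. Letting x run
over both signs accounts for the two opposite rays of each slope. *)
Lemma area_slopes (D : set (borelR * borelR)) : measurable D ->
  ((mu \x mu) D = \int[mu]_t \int[mu]_x (`|x| * \1_D (x, x * t)%R)%:E)%E.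
Proof.
move=> mD.
pose f (p : borelR * borelR) := (`|p.1| * \1_D (p.1, p.1 * p.2))%:E.
have mf : measurable_fun setT f.
  apply/measurable_EFinP; apply: measurable_funM.
    by apply: measurableT_comp => //.
  have m1 : measurable_fun setT (\1_D : borelR * borelR -> borelR).
    exact: measurable_indic.
  have m2 : measurable_fun setT (fun p : borelR * borelR =>
      (p.1, (p.1 * p.2)%R) : borelR * borelR).
    apply/measurable_fun_pairP; split => //=; first exact: measurable_fst.
    by apply: measurable_funM; [exact: measurable_fst|exact: measurable_snd].
  exact: measurableT_comp m1 m2.
have f0 p : (0 <= f p)%E by rewrite lee_fin mulr_ge0.
have -> : (\int[mu]_t \int[mu]_x (`|x| * \1_D (x, x * t)%R)%:E =
   \int[mu]_x \int[mu]_t f (x, t))%E by rewrite (fubini_tonelli f mf f0).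
have mF := measurable_fun_fubini_tonelli_F (m2 := mu) f mf f0.
have mX := measurable_fun_xsection mu mD.
rewrite /product_measure1 -[LHS](@integral_setD1 _ _ 0); last 2 first.
- exact: measurableD.
- exact: measurable_funTS mX.
rewrite -[RHS](@integral_setD1 _ _ 0); last 2 first.
- exact: measurableD.
- exact: measurable_funTS mF.
apply: eq_integral => x; rewrite inE/= => -[_ /eqP x0].
have ms : measurable (xsection D x) by exact: measurable_xsection.
rewrite (lebesgue_measure_scale x0 ms).
have mp : measurable ((fun t => (x * t)%R) @^-1` xsection D x).
  by rewrite -[X in measurable X]setTI; apply: mulrl_measurable.
rewrite /f/= (_ : (fun t => _) =
  (fun t => (`|x|%:E * (\1_((fun t => (x * t)%R) @^-1` xsection D x)
  t)%:E))%E); last first.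
  apply/funext => t; rewrite -EFinM !indicE; congr (_ * _)%:E.
  congr (_%:R); congr (nat_of_bool _).
  by apply/idP/idP; rewrite !inE /= /xsection/= inE.
rewrite ge0_integralZl//.
  by rewrite integral_indic// setIT.
by apply/measurable_EFinP; exact: measurable_indic.
Qed.

End Slopes.

(** * Periodicity of the cosine powers *)

Section Antiderivative.
Context {R : realType}.
Local Notation mu := (@lebesgue_measure R).

(** The integral from b is an antiderivative only to the right of b; since b is
arbitrary this is as good as an antiderivative on the line. *)
Lemma continuous_antiderivative (f : R -> R) (b : R) : continuous f ->
  exists F : R -> R, forall x, b < x -> is_derive x 1 F (f x).
Proof.
move=> cf; exists (fun x => \int[mu]_(t in `[b, x]) f t)%R => x bx.
have ifx : mu.-integrable `[b, x + 1] (EFin \o f).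
  apply: continuous_compact_integrable; first exact: segment_compact.
  by apply: continuous_in_within => y _; exact: cf.
have xx1 : x < x + 1 by rewrite ltrDl.
have [d1 d2] := continuous_FTC1_closed xx1 ifx bx (cf x).
by split => //; rewrite -derive1E.
Qed.

Lemma is_derive_comp_addr (F : R -> R) (c x df : R) :
  is_derive (x + c) 1 F df -> is_derive x 1 (fun y => F (y + c)) df.
Proof.
move=> h; have h2 : is_derive x 1 (fun y : R => y + c) 1.
  by apply: (is_derive_eq (is_deriveD (is_derive_id x 1)
    (is_derive_cst c x 1))); rewrite addr0.
by have := @is_derive1_comp R F (fun y => y + c) x df 1 h h2; rewrite mulr1.
Qed.

Lemma cos_pow_periodic (s x : R) : cos_pow s (x + 2 * pi) = cos_pow s x.
Proof. by rewrite /cos_pow mulrC mulr_natr cosD2pi. Qed.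

(** By periodicity F (x + 2 pi) - F x has derivative 0. Its constant value is read
at - pi/2: it is cos_int s, because cos_pow s vanishes on [pi/2, 3 pi/2], which
requires s <> 0. *)
Lemma cos_pow_antiderivative_period (s b : R) (F : R -> R) : 0 < s ->
  b < - (pi / 2) ->
  (forall x, b < x -> is_derive x 1 F (cos_pow s x)) ->
  forall n x, b < x -> F (x + 2 * pi * n%:R) - F x = n%:R * cos_int s.
Proof.
move=> s0 bpi dF.
have pi0 := @pi_gt0 R.
have s0' := ltW s0.
pose D x := F (x + 2 * pi) - F x.
have dD x : b < x -> is_derive x 1 D (cst 0 x).
  move=> bx.
  have h : is_derive (x + 2 * pi) 1 F (cos_pow s (x + 2 * pi)).
    by apply: dF; rewrite (lt_trans bx)// ltrDl mulr_gt0.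
  apply: (is_derive_eq (is_deriveB (is_derive_comp_addr h) (dF x bx))).
  by rewrite cos_pow_periodic subrr.
have Dc x y : b < x -> x < y -> D x = D y.
  move=> bx xy.
  have H : (\int[mu]_(z in `[x, y]) (cst 0 z : R)%:E = (D y - D x)%:E)%E.
    apply: is_derive_FTC2 => // z; last by move=> _; exact: cst_continuous.
    by move=> /andP[xz _]; apply: dD; exact: lt_le_trans xz.
  rewrite integral0_eq// in H; have {}H := EFin_inj H.
  by apply/esym/eqP; rewrite -subr_eq0 -H.
have DD x y : b < x -> b < y -> D x = D y.
  move=> bx byy; have [xy|yx|->//] := ltgtP x y; first exact: Dc.
  exact/esym/Dc.
have DE x : b < x -> D x = cos_int s.
  move=> bx; rewrite (DD _ (- (pi / 2)))//.
  have e1 : - (pi / 2) + 2 * pi = pi / 2 + pi :> R by field.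
  rewrite /D e1.
  have p1 : - (pi / 2) < pi / 2 :> R by lra.
  have p2 : pi / 2 < pi / 2 + pi :> R by lra.
  have b2 : b < pi / 2 by lra.
  have i1 : (cos_int s)%:E = (F (pi / 2) - F (- (pi / 2)))%:E.
    rewrite /cos_int /Rintegral fineK; last first.
      by apply: integrable_fin_num => //; exact: cos_pow_integrable.
    apply: is_derive_FTC2 => // z; last by move=> _; exact: continuous_cos_pow.
    by move=> /andP[h _]; apply: dF; exact: lt_le_trans h.
  have i2 : 0%E = (F (pi / 2 + pi) - F (pi / 2))%:E.
    transitivity (\int[mu]_(z in `[(pi / 2)%R, (pi / 2 + pi)%R])
      (cst 0 z : R)%:E)%E.
      by rewrite integral0_eq.
    apply: is_derive_FTC2 => // z; last by move=> _; exact: cst_continuous.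
    move=> /andP[h h']; have := dF z (lt_le_trans b2 h).
    rewrite (_ : cos_pow s z = 0)// /cos_pow max_r ?powR0 ?gt_eqF//.
    rewrite -[z](subrK pi) cosDpi oppr_le0 cos_ge0_pihalf//.
    by apply/andP; split; lra.
  have := EFin_inj i1; have := EFin_inj i2; lra.
elim=> [|n IH] x bx; first by rewrite mulr0 addr0 subrr mul0r.
have bx' : b < x + 2 * pi * n%:R by rewrite (lt_le_trans bx)// lerDl
  !mulr_ge0// ltW.
have h1 := IH _ bx; have h2 := DE _ bx'; rewrite /D in h2.
rewrite -[n.+1%:R]natr1 [RHS]mulrDl mul1r -h1 -h2.
have -> : x + 2 * pi * (n%:R + 1) = x + 2 * pi * n%:R + 2 * pi by ring.
ring.
Qed.

End Antiderivative.

(** * The leaves of the lemniscate *)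

Section Region.
Context {R : realType}.
Local Notation mu := (@lebesgue_measure R).
Local Notation borelR := (measurableTypeR R).
Local Open Scope complex_scope.
Implicit Types (x y t r C : R) (m n : nat).

Lemma de_moivre r t n :
  ((r * cos t) +i* (r * sin t)) ^+ n = (r ^+ n * cos (n%:R * t)) +i*
    (r ^+ n * sin (n%:R * t)).
Proof.
elim: n => [|n IH]; first by rewrite mul0r cos0 sin0 !expr0 mulr1 mulr0.
rewrite exprS IH -natr1 mulrDl mul1r cosD sinD exprS.
by apply/eqP; rewrite eq_complex/=; apply/andP; split; apply/eqP; ring.
Qed.

Lemma lemniscate_regionE m (w : R[i]) : @lemniscate_region R m w =
  ((complex.Re (w ^+ m) - 1) ^+ 2 + complex.Im (w ^+ m) ^+ 2 < 1) :> Prop.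
Proof.
rewrite /lemniscate_region/=; case: (w ^+ m) => p q /=; simpc.
by rewrite -[X in (_ < X)]sqrtr1 ltr_sqrt.
Qed.

(** Expand |r^m exp (i m t) - 1|^2 < 1 and cancel 1. The radius r may be negative:
lines through the origin are parametrized by a signed radius. *)
Lemma lemniscate_region_polar m r t :
  @lemniscate_region R m ((r * cos t) +i* (r * sin t)) =
  ((r ^+ m) ^+ 2 < r ^+ m * (2 * cos (m%:R * t))) :> Prop.
Proof.
rewrite lemniscate_regionE de_moivre/=; congr (is_true _).
rewrite -subr_lt0 -[RHS]subr_lt0; congr (_ < 0).
rewrite [(_ * sin _) ^+ 2]exprMn sin2cos2; ring.
Qed.

(** The distance from the origin to the boundary in the direction of angle t / m; it
is 0 when this direction points between two leaves. *)
Definition leaf_radius m t : R := (2 * Num.max (cos t) 0) `^ m%:R^-1.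

Lemma leaf_radius_ge0 m t : 0 <= leaf_radius m t. Proof. exact: powR_ge0. Qed.

Lemma leaf_radius_sqr m t : (0 < m)%N ->
  leaf_radius m t ^+ 2 = 4 `^ m%:R^-1 * cos_pow (2 * m%:R^-1) t.
Proof.
move=> m0; have h : 0 <= Num.max (cos t) 0 by rewrite le_max lexx orbT.
rewrite /leaf_radius /cos_pow powRM// exprMn; congr (_ * _).
  by rewrite expr2 -powRM// -natrM.
by rewrite -powR_mulrn ?powR_ge0// -powRrM mulrC.
Qed.

Lemma lt_leaf_radius m r t : (0 < m)%N -> 0 < r ->
  ((r ^+ m) ^+ 2 < r ^+ m * (2 * cos t)) = (r < leaf_radius m t).
Proof.
move=> m0 r0; have rm : 0 < r ^+ m by rewrite exprn_gt0.
have mR : 0 < m%:R :> R by rewrite ltr0n.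
have mV : 0 < m%:R^-1 :> R by rewrite invr_gt0.
rewrite expr2 ltr_pM2l// /leaf_radius.
have [c0|c0] := leP (cos t) 0.
  rewrite mulr0 powR0 ?gt_eqF//; apply/idP/idP => h.
    by have := lt_trans rm h; rewrite pmulr_rgt0// ltNge c0.
  by have := lt_trans r0 h; rewrite ltxx.
have c2 : 0 <= 2 * cos t by rewrite mulr_ge0// ltW.
have er : r = (r ^+ m) `^ m%:R^-1.
  by rewrite -powR_mulrn ?(ltW r0)// -powRrM divff ?gt_eqF// powRr1// ltW.
rewrite [in RHS]er; apply/idP/idP => h.
  by apply: gt0_ltr_powR => //; rewrite nnegrE// ltW.
rewrite ltNge; apply/negP => h'.
have : (2 * cos t) `^ m%:R^-1 <= (r ^+ m) `^ m%:R^-1.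
  by apply: ge0_ler_powR; rewrite ?nnegrE// ltW.
by rewrite leNgt h.
Qed.

(** The line of slope t carries the rays of angle atan t and atan t + pi. The m-th
multiples of these angles are u and u + m pi, and the abscissa of a point is its
signed radius times c. *)
Lemma lemniscate_region_slope m t x : (0 < m)%N -> let c := cos (atan t) in let
  u := m%:R * atan t in
  (`|x| * \1_[set p : R * R | @lemniscate_region R m (p.1 +i* p.2)]
    (x, x * t))%R =
  x * \1_(`]0, c * leaf_radius m u[%classic) x
  + - x * \1_(`](- (c * leaf_radius m (u + pi *+ m))), 0[%classic) x.
Proof.
move=> m0 c u; set D := [set p | _].
have c0 : 0 < c by apply: cos_gt0_pihalf; rewrite atan_gtNpi2 atan_ltpi2.
have e : (x, x * t).1 +i* (x, x * t).2 = (x / c * cos (atan t)) +i*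
  (x / c * sin (atan t)).
  have ht : t = sin (atan t) / c by rewrite -[LHS](atanK t).
  rewrite /= divfK ?gt_eqF//; congr (_ +i* _).
  by rewrite {1}ht; ring.
have key : D (x, x * t) = (((x / c) ^+ m) ^+ 2 < (x / c) ^+ m * (2 * cos u)) :>
  Prop.
  by rewrite -lemniscate_region_polar -[x * t]/((x, x * t).2) -e.
have cm : cos (u + pi *+ m) = (- 1) ^+ m * cos u by exact:
  (alternatingn (@cosDpi R)).
have [x0|x0|->] := ltgtP x 0; last by rewrite normr0 oppr0 !mul0r addr0.
- have -> : \1_(`]0%R, (c * leaf_radius m u)%R[%classic) x = 0 :> R.
    by rewrite indicE memNset//= in_itv/= => /andP[]; rewrite ltNge (ltW x0).
  rewrite mulr0 add0r ltr0_norm//; congr (_ * _); rewrite !indicE.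
  have r0 : 0 < - (x / c) by rewrite oppr_gt0 pmulr_llt0// invr_gt0.
  have := lt_leaf_radius (u + pi *+ m) m0 r0.
  rewrite cm [(- (x / c)) ^+ m]exprNn exprMn sqrr_sign mul1r
    [2 * (_ * _)]mulrCA [_ * (_ * (2 * _))]mulrACA.
  rewrite -[(-1) ^+ m * (-1) ^+ m]expr2 sqrr_sign mul1r ltrNl ltr_pdivlMr//
    mulNr.
  rewrite [leaf_radius _ _ * c]mulrC => k.
  by congr (_%:R); congr (nat_of_bool _); apply/idP/idP;
    rewrite !inE/= key k in_itv/= x0 andbT.
- have -> : \1_(`](- (c * leaf_radius m (u + pi *+ m)))%R, 0%R[%classic) x =
  0 :> R.
    by rewrite indicE memNset//= in_itv/= => /andP[_]; rewrite ltNge (ltW x0).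
  rewrite mulr0 addr0 gtr0_norm//; congr (_ * _); rewrite !indicE.
  have r0 : 0 < x / c by rewrite divr_gt0.
  have := lt_leaf_radius u m0 r0; rewrite ltr_pdivrMr// [_ * c]mulrC => k.
  by congr (_%:R); congr (nat_of_bool _); apply/idP/idP;
    rewrite !inE/= key k in_itv/= x0.
Qed.

Lemma integral_radius_pos (p : R) : 0 <= p ->
  (\int[mu]_x (x * \1_(`]0, p[%classic) x)%:E = (p ^+ 2 / 2)%:E)%E.
Proof.
move=> p0.
have -> : (\int[mu]_x (x * \1_(`]0, p[%classic) x)%:E = \int[mu]_(x in `]0%R,
  p[) x%:E)%E.
  rewrite [RHS]integral_mkcond; apply: eq_integral => x _.
  rewrite patchE indicE; case: (x \in _); rewrite ?mulr1 ?mulr0//.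
move: p0; rewrite le_eqVlt => /predU1P[<-|p0].
  by rewrite set_itvoo0 integral_set0 expr0n mul0r.
rewrite -(integral_itv_bndoo true false); last by apply/measurable_EFinP.
have d (x : R) : is_derive x 1 (fun x => x ^+ 2 / 2) x.
  by apply: is_derive_eq; rewrite /GRing.scale/=; field.
have h : (\int[mu]_(x in `[0%R, p]) x%:E = (p ^+ 2 / 2 - 0 ^+ 2 / 2)%:E)%E.
  apply: (is_derive_FTC2 (F := fun x => x ^+ 2 / 2)) => // x _; exact: cvg_id.
by rewrite h expr0n mul0r subr0.
Qed.

Lemma integral_radius_neg (p : R) : 0 <= p ->
  (\int[mu]_x (- x * \1_(`](- p)%R, 0[%classic) x)%:E = (p ^+ 2 / 2)%:E)%E.
Proof.
move=> p0; rewrite -integral_radius_pos//.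
have mN : measurable_fun setT (fun x : borelR => (- x)%R : borelR).
  exact: oppr_measurable.
pose f (x : borelR) : \bar R := (x * \1_(`]0, p[%classic) x)%:E.
have mf : measurable_fun setT f.
  by apply/measurable_EFinP; apply: measurable_funM => //;
    exact: measurable_indic.
have f0 x : (0 <= f x)%E.
  rewrite lee_fin indicE; have [|_] := boolP (x \in _); last by rewrite mulr0.
  by rewrite inE/= in_itv/= => /andP[/ltW x0 _]; rewrite mulr_ge0.
transitivity (\int[pushforward mu (fun x : borelR => (- x)%R : borelR)]_x f x)%E.
  rewrite ge0_integral_pushforward// preimage_setT; apply: eq_integral => x _.
  rewrite /f/= !indicE; congr (_ * (nat_of_bool _)%:R)%:E.
  by apply/idP/idP; rewrite !inE/= !in_itv/= oppr_gt0 ltrNl andbC.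
by apply: eq_measure_integral => A mA _; exact: lebesgue_measureN.
Qed.

Lemma measurable_lemniscate_region m :
  measurable ([set p | @lemniscate_region R m (p.1 +i* p.2)] : set (borelR * borelR)).
Proof.
pose P := (borelR * borelR)%type.
have H n : measurable_fun setT (fun p : P => complex.Re ((p.1 +i* p.2) ^+ n) :
  borelR) /\
     measurable_fun setT (fun p : P => complex.Im ((p.1 +i* p.2) ^+ n) : borelR).
  elim: n => [|n [h1 h2]].
    by split; under eq_fun do rewrite expr0/=; exact: measurable_cst.
  have m1 : measurable_fun setT (fun p : P => p.1) by exact: measurable_fst.
  have m2 : measurable_fun setT (fun p : P => p.2) by exact: measurable_snd.
  split.
    rewrite (_ : (fun p => _) =
      (fun p : P => p.1 * complex.Re ((p.1 +i* p.2) ^+ n) - p.2 * complex.Im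
      ((p.1 +i* p.2) ^+ n))).
      by apply: measurable_funB; apply: measurable_funM.
    by apply/funext => p; rewrite exprS; case: (_ ^+ n).
  rewrite (_ : (fun p => _) =
    (fun p : P => p.1 * complex.Im ((p.1 +i* p.2) ^+ n) + p.2 * complex.Re
    ((p.1 +i* p.2) ^+ n))).
    by apply: measurable_funD; apply: measurable_funM.
  by apply/funext => p; rewrite exprS; case: (_ ^+ n).
have [h1 h2] := H m.
pose f (p : P) : borelR := (complex.Re ((p.1 +i* p.2) ^+ m) - 1) ^+ 2 + complex.Im
  ((p.1 +i* p.2) ^+ m) ^+ 2.
have mf : measurable_fun setT f.
  apply: measurable_funD; apply: measurable_funX => //.
  by apply: measurable_funB.
rewrite (_ : [set p | _] = setT `&` f @^-1` `]-oo, 1[).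
  by apply: mf.
rewrite setTI; apply/seteqP; split => p /=;
  rewrite in_itv/= /f lemniscate_regionE//.
Qed.

End Region.

(** * Area of the leaves *)

Section Area.
Context {R : realType}.
Local Notation mu := (@lebesgue_measure R).
Local Notation borelR := (measurableTypeR R).
Local Open Scope complex_scope.
Context (m : nat) (m0 : (0 < m)%N).
Let a : R := m%:R^-1.
Let D := [set p : borelR * borelR | @lemniscate_region R m (p.1 +i* p.2)].

Definition slope_density t : R :=
  4 `^ a / 2 * (cos_pow (2 * a) (m%:R * atan t)
                + cos_pow (2 * a) (m%:R * atan t + pi *+ m)) / (1 + t ^+ 2).

(** The factor 1 / (1 + t^2) is the square of the cosine of atan t; it will be
absorbed as the derivative of atan. *)
Lemma integral_lemniscate_region_slope t :
  (\int[mu]_x (`|x| * \1_D (x, x * t)%R)%:E = (slope_density t)%:E)%E.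
Proof.
have c0 : 0 < cos (atan t) by apply: cos_gt0_pihalf;
  rewrite atan_gtNpi2 atan_ltpi2.
set u := m%:R * atan t.
pose b1 := cos (atan t) * leaf_radius m u.
pose b2 := cos (atan t) * leaf_radius m (u + pi *+ m).
have b10 : 0 <= b1 by rewrite mulr_ge0 ?leaf_radius_ge0 ?(ltW c0).
have b20 : 0 <= b2 by rewrite mulr_ge0 ?leaf_radius_ge0 ?(ltW c0).
have E x : ((`|x| * \1_D (x, x * t)%R)%:E =
   (x * \1_(`]0%R, b1[%classic) x)%:E + (- x * \1_(`](- b2)%R, 0%R[%classic)
     x)%:E)%E.
  by rewrite -EFinD; congr EFin; exact: lemniscate_region_slope.
under eq_integral do rewrite E.
have n1 (x : borelR) : (0 <= (x * \1_(`]0%R, b1[%classic) x)%:E)%E.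
  rewrite lee_fin indicE; have [|_] := boolP (x \in _); last by rewrite mulr0.
  by rewrite inE/= in_itv/= => /andP[/ltW x0 _]; rewrite mulr_ge0.
have n2 (x : borelR) : (0 <= (- x * \1_(`](- b2)%R, 0%R[%classic) x)%:E)%E.
  rewrite lee_fin indicE; have [|_] := boolP (x \in _); last by rewrite mulr0.
  by rewrite inE/= in_itv/= => /andP[_ /ltW x0]; rewrite mulr_ge0// oppr_ge0.
rewrite ge0_integralD//=; last 2 first.
- by apply/measurable_EFinP; apply: measurable_funM => //;
  exact: measurable_indic.
- by apply/measurable_EFinP; apply: measurable_funM => //;
  exact: measurable_indic.
rewrite integral_radius_pos// integral_radius_neg// -EFinD; congr EFin.
rewrite /b1 /b2 !exprMn !leaf_radius_sqr// /slope_density -/a -/u.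
have -> : cos (atan t) ^+ 2 = (1 + t ^+ 2)^-1.
  by rewrite cos_atan exprVn sqr_sqrtr// addr_ge0// sqr_ge0.
have q : 1 + t ^+ 2 != 0 by rewrite gt_eqF// ltr_wpDr// sqr_ge0.
by field.
Qed.

(** As t runs over the line, m atan t runs over an interval of length m pi, and
m atan t + m pi over the next one. Together they cover m periods of cos_pow,
one for each leaf, and the substitution contributes a factor 1 / m. *)
Lemma area_lemniscate_region : @area R (@lemniscate_region R m) =
  (4 `^ a / 2 * cos_int (2 * a))%:E.
Proof.
have a0 : 0 < a by rewrite invr_gt0 ltr0n.
have s0 : 0 < 2 * a by rewrite mulr_gt0.
have ma : m%:R * a = 1 by rewrite divff// pnatr_eq0 -lt0n.
have mR : 0 < m%:R :> R by rewrite ltr0n.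
have pi0 := @pi_gt0 R.
rewrite /area -/D area_slopes; last exact: measurable_lemniscate_region.
under eq_integral do rewrite integral_lemniscate_region_slope.
(* every angle met below is to the right of b *)
pose b : R := - (m%:R * (pi / 2)) - 1.
have [F dF] := continuous_antiderivative b (continuous_cos_pow (ltW s0)).
have p2 : 0 < pi / 2 :> R by rewrite divr_gt0.
have mp : pi / 2 <= m%:R * (pi / 2) :> R by rewrite ler_peMl ?(ltW p2)// ler1n.
have bp : b < - (pi / 2) by rewrite /b; lra.
pose G t : R := 4 `^ a / 2 * a *
  (F (m%:R * atan t) + F (m%:R * atan t + pi *+ m)).
have pm : 0 <= pi *+ m :> R by rewrite mulrn_wge0// ltW.
have ub t : b < m%:R * atan t.
  have : m%:R * - (pi / 2) < m%:R * atan t by rewrite ltr_pM2l// atan_gtNpi2.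
  by rewrite mulrN /b; lra.
have ub' t : b < m%:R * atan t + pi *+ m by rewrite ltr_wpDr.
have dG (t : R) : is_derive t 1 G (slope_density t).
  have d0 : is_derive t 1 (fun t : R => m%:R * atan t : R)
    (m%:R * (1 + t ^+ 2)^-1).
    by apply: (is_derive_eq (is_deriveZ m%:R (is_derive1_atan t))).
  have d1 := @is_derive1_comp R F (fun t : R => m%:R * atan t) t _ _
    (dF _ (ub t)) d0.
  have d2 := @is_derive1_comp R (fun y => F (y + pi *+ m)) (fun t : R =>
    m%:R * atan t) t _ _ (is_derive_comp_addr (dF _ (ub' t))) d0.
  apply: (is_derive_eq (is_deriveZ (4 `^ a / 2 * a) (is_deriveD d1 d2))).
  rewrite /slope_density /GRing.scale/=.
  transitivity (4 `^ a / 2 * (m%:R * a) * (cos_pow (2 * a) (m%:R * atan t) +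
    cos_pow (2 * a) (m%:R * atan t + pi *+ m))
  / (1 + t ^+ 2)); first by ring.
  by rewrite ma mulr1.
have cF x : b < x -> {for x, continuous F} by move=> bx;
  exact: (is_derive1_continuous (dF _ bx)).
have bm1 : b < - (m%:R * (pi / 2)) by rewrite /b; lra.
have bm2 : b < m%:R * (pi / 2) by rewrite /b; lra.
have cdens (t : R) : {for t, continuous slope_density}.
  have ca : {for t, continuous (fun t => m%:R * atan t)}.
    by apply: cvgM; [exact: cvg_cst|exact: continuous_atan].
  have q : 1 + t ^+ 2 != 0 by rewrite gt_eqF// ltr_wpDr// sqr_ge0.
  apply: cvgM; last first.
    apply: cvgV => //; apply: cvgD; first exact: cvg_cst.
    exact: exprn_continuous.
  apply: cvgM; first exact: cvg_cst.
  apply: cvgD.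
    apply: (@continuous_comp _ _ _ (fun t => m%:R * atan t) (cos_pow (2 * a)))
      => //.
    exact: (continuous_cos_pow (ltW s0)).
  apply: (@continuous_comp _ _ _ (fun t => m%:R * atan t + pi *+ m)
    (cos_pow (2 * a))).
    by apply: cvgD => //; exact: cvg_cst.
  exact: (continuous_cos_pow (ltW s0)).
have an : nonincreasing_seq (fun n => - (n.+1%:R : R)).
  by apply/nonincreasing_seqP => n; rewrite lerN2 ler_nat.
have bn : nondecreasing_seq (fun n => n.+1%:R : R).
  by apply/nondecreasing_seqP => n; rewrite ler_nat.
have atny : atan (n.+1%:R : R) @[n --> \oo] --> pi / 2.
  apply: (cvg_comp (fun n => n.+1%:R : R) (@atan R)); last exact: cvgy_atan.
  rewrite (cvg_shiftS (fun n => n%:R : R)); exact: cvgr_idn.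
have lim (v : R^nat) (l : R) : v n @[n --> \oo] --> l -> b < m%:R * l ->
    4 `^ a / 2 * a * (F (m%:R * v n) + F (m%:R * v n + pi *+ m)) @[n --> \oo]
      -->
    4 `^ a / 2 * a * (F (m%:R * l) + F (m%:R * l + pi *+ m)).
  move=> vl bl; apply: cvgM; first exact: cvg_cst.
  have vm : m%:R * v n @[n --> \oo] --> m%:R * l by apply: cvgM => //;
    exact: cvg_cst.
  apply: cvgD.
    by apply: (cvg_comp (fun n => m%:R * v n) F vm); exact: cF.
  have vm' : m%:R * v n + pi *+ m @[n --> \oo] --> m%:R * l + pi *+ m.
    by apply: cvgD => //; exact: cvg_cst.
  by apply: (cvg_comp (fun n => m%:R * v n + pi *+ m) F vm'); apply: cF;
    rewrite ltr_wpDr.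
have lb := lim _ _ atny bm2.
have la : G (- n.+1%:R) @[n --> \oo] --> 
    4 `^ a / 2 * a * (F (m%:R * - (pi / 2)) + F (m%:R * - (pi / 2) + pi *+ m)).
  apply: lim; last by rewrite mulrN.
  rewrite (_ : (fun n => _) = fun n => - atan (n.+1%:R : R)); first exact: cvgN.
  by apply/funext => n; rewrite atanN.
have H : (\int[mu]_t (slope_density t)%:E =
   (4 `^ a / 2 * a * (F (m%:R * (pi / 2)) + F (m%:R * (pi / 2) + pi *+ m)) -
    4 `^ a / 2 * a * (F (m%:R * - (pi / 2)) + F
      (m%:R * - (pi / 2) + pi *+ m)))%:E)%E.
  apply: (ge0_FTC2_exhaust an bn bigcup_itv_setT (F := G)) => //.
  - by move=> n; rewrite gtrN.
  - move=> t _; rewrite divr_ge0//; last by rewrite addr_ge0// sqr_ge0.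
    by rewrite mulr_ge0 ?divr_ge0 ?powR_ge0// addr_ge0// cos_pow_ge0.
rewrite H; congr EFin.
have := cos_pow_antiderivative_period s0 bp dF m bm1.
set K := cos_int _.
have e1 : m%:R * - (pi / 2) + pi *+ m = m%:R * (pi / 2) :> R by rewrite
  -mulr_natr; field.
have e2 : m%:R * (pi / 2) + pi *+ m = - (m%:R * (pi / 2)) + 2 * pi * m%:R :> R.
  by rewrite -mulr_natr; field.
rewrite e1 e2 mulrN => e3.
transitivity (4 `^ a / 2 * a * (m%:R * K)); first by rewrite -e3; ring.
transitivity (4 `^ a / 2 * (m%:R * a) * K); first by ring.
by rewrite ma mulr1.
Qed.

End Area.

(** * The boundary curve *)

Section Boundary.
Context {R : realType}.
Local Open Scope complex_scope.
Implicit Types (z w : R[i]) (m : nat).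

Lemma normc_principal_arg z :
  (Normc.normc z * cos (principal_arg z)) +i*
    (Normc.normc z * sin (principal_arg z)) = z.
Proof.
have [->|z0] := eqVneq z 0; first by rewrite Normc.normc0 !mul0r.
have n0 : 0 < Normc.normc z.
  rewrite lt_neqAle; apply/andP; split; last by case: (z) => x y /=;
    rewrite sqrtr_ge0.
  by apply: contra z0; rewrite eq_sym => /eqP /Normc.eq0_normc ->.
case: z z0 n0 => x y z0 n0; rewrite /principal_arg.
set r := Normc.normc _ in n0 *; rewrite [complex.Re _]/= [complex.Im _]/=.
have rr : r ^+ 2 = x ^+ 2 + y ^+ 2 by rewrite /r/= sqr_sqrtr// addr_ge0//
  sqr_ge0.
have q1 : -1 <= x / r <= 1.
  rewrite -ler_norml normrM normfV (gtr0_norm n0) ler_pdivrMr// mul1r.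
  by rewrite -ler_sqr ?nnegrE ?(ltW n0)// real_normK ?num_real// rr lerDl
    sqr_ge0.
have c : cos (acos (x / r)) = x / r by rewrite acosK// in_itv.
have s : r * sin (acos (x / r)) = `|y|.
  have e : r = Num.sqrt (r ^+ 2) by rewrite sqrtr_sqr gtr0_norm.
  rewrite sin_acos// {1}e -sqrtrM ?sqr_ge0// -sqrtr_sqr; congr Num.sqrt.
  by rewrite mulrBr mulr1 expr_div_n [_ * (_ / _)]mulrC divfK ?expf_neq0
    ?gt_eqF// rr addrC addKr.
have [y0|y0] := leP 0 y.
  rewrite c s ger0_norm//; congr (_ +i* _); rewrite mulrC divfK ?gt_eqF//.
rewrite cosN sinN c mulrN s ltr0_norm// opprK; congr (_ +i* _).
by rewrite mulrC divfK ?gt_eqF.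
Qed.

Lemma principal_rootK m z : (0 < m)%N -> principal_root m z ^+ m = z.
Proof.
move=> m0; rewrite /principal_root de_moivre.
have mR : m%:R != 0 :> R by rewrite pnatr_eq0 -lt0n.
have n0 : 0 <= Normc.normc z by case: (z) => x y /=; rewrite sqrtr_ge0.
rewrite -powR_mulrn ?powR_ge0// -powRrM mulVf// powRr1// [m%:R * _]mulrC
  divfK//.
exact: normc_principal_arg.
Qed.

Lemma Psi_exprn m z : (0 < m)%N -> z != 0 -> Psi m z ^+ m = z ^+ m + 1.
Proof.
move=> m0 z0; rewrite /Psi exprMn principal_rootK// mulrDr mulr1 mulfV//.
by rewrite expf_neq0.
Qed.

(** If w^m - 1 = z0^m, then w and Psi(z0) have the same m-th power, so they differ
by an m-th root of unity om; as Psi (om z) = om Psi z, the point om z0 is mapped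
to w. At w = 0 the quotient is not defined, but then Psi(z0) = 0 as well. *)
Lemma Psi_unit_circle m : (0 < m)%N ->
  @Psi R m @` [set z : R[i] | `|z| = 1] = @lemniscate R m.
Proof.
move=> m0; apply/seteqP; split => [_ [z /= z1 <-]|w /= w1].
  have z0 : z != 0 by rewrite -normr_eq0 z1 oner_eq0.
  by rewrite /lemniscate/= Psi_exprn// addrK normrX z1 expr1n.
rewrite /lemniscate/= in w1.
pose z0 := principal_root m (w ^+ m - 1).
have e0 : z0 ^+ m = w ^+ m - 1 by exact: principal_rootK.
have n0 : `|z0| = 1.
  by apply/eqP; rewrite -(@pexpr_eq1 _ _ m)// -normrX e0 w1.
have z00 : z0 != 0 by rewrite -normr_eq0 n0 oner_eq0.
have ew : Psi m z0 ^+ m = w ^+ m by rewrite Psi_exprn// e0 subrK.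
have [w0|w0] := eqVneq w 0.
  exists z0 => //; rewrite w0; apply/eqP; have := expf_eq0 (Psi m z0) m.
  by rewrite m0 ew w0 expr0n gtn_eqF// eqxx => /esym.
have p0 : Psi m z0 != 0.
  by apply: contra w0 => /eqP p; move: ew;
    rewrite p expr0n gtn_eqF// => /esym/eqP; rewrite expf_eq0 => /andP[].
pose om := w / Psi m z0.
have om1 : om ^+ m = 1 by rewrite /om expr_div_n ew divff// expf_neq0.
exists (z0 * om).
  rewrite /= normrM n0 mul1r; apply/eqP;
    rewrite -(@pexpr_eq1 _ _ m)// -normrX om1 normr1//.
rewrite /Psi exprMn om1 mulr1 mulrAC -/(Psi m z0) /om mulrC divfK//.
Qed.

End Boundary.

Theorem theorem7 (R : realType) (m : nat) (hm : (2 <= m)%N) :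
  [/\ @Psi R m @` [set z : R[i] | `|z| = 1] = @lemniscate R m,
      cvgn (fun N : nat => \sum_(0 <= n < N) gbinom (m%:R^-1 : R) n ^+ 2),
      cvgn (fun N : nat => \sum_(1 <= n < N) n%:R * gbinom (m%:R^-1 : R) n ^+
        2),
      area (@lemniscate_region R m) =
        (pi * (\big[+%R/0]_(0 <= n <oo) gbinom (m%:R^-1 : R) n ^+ 2
               - m%:R * \big[+%R/0]_(1 <= n <oo) (n%:R * gbinom (m%:R^-1 : R) n
                 ^+ 2)))%:E
    & area (@lemniscate_region R m) =
        (2 `^ (2 / m%:R - 1) * (Gamma (m%:R^-1 + 2^-1 : R) / Gamma
          (m%:R^-1 + 1 : R))
         * Num.sqrt pi)%:E].
Proof.
have m0 : (0 < m)%N by apply: leq_trans hm.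
have mR : m%:R != 0 :> R by rewrite pnatr_eq0 -lt0n.
rewrite area_lemniscate_region//.
set a : R := m%:R^-1.
have a01 : 0 < a < 1 by rewrite invr_gt0 ltr0n m0 invf_lt1 ?ltr0n// ltr1n.
have /andP[a0 a1] := a01.
have E0 : (fun N : nat => \sum_(0 <= n < N) gbinom a n ^+ 2) =
  series (gauss_term a 0).
  by apply/funext => N; apply: eq_bigr => n _; rewrite gauss_term_gbinom.
have E1 : (fun N : nat => \sum_(1 <= n < N) n%:R * gbinom a n ^+ 2) =
    series (fun n => n%:R * gauss_term a 0 n).
  apply/funext => -[|N]; rewrite /series/=; first by rewrite !big_geq.
  rewrite [RHS]big_ltn// mul0r add0r.
  by apply: eq_bigr => n _; rewrite gauss_term_gbinom.
rewrite E0 E1 cos_int_wallis; last by rewrite !ltW.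
split.
- exact: Psi_unit_circle.
- exact: cvg_gauss_sum0.
- exact: cvg_gauss_sum1.
- congr EFin; have := gauss_sum_gosper a01;
  rewrite -/(gauss_sum a 0) gauss_sum_wallis//.
  set S1 := limn _ => h.
  have -> : S1 = a * (4 `^ a * wallis_lim a) / 2 by rewrite h mulrC mulKf.
  rewrite /a; field.
  by [].
- congr EFin; rewrite /wallis_lim Gamma_half.
  have -> : 2 `^ (2 / m%:R - 1) = 4 `^ a / 2 :> R.
    rewrite powRD ?pnatr_eq0 ?implybT// powRrM -/a powR_inv1// powR_mulrn//.
    by rewrite -natrX.
  have s0 : Num.sqrt pi != 0 :> R by rewrite gt_eqF// sqrtr_gt0 pi_gt0.
  have g0 : Gamma (a + 1) != 0 by rewrite gt_eqF// Gamma_gt0// ltr_wpDr// ltW.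
  rewrite -[X in X * (_ / _)](sqr_sqrtr (@pi_ge0 R)) [1 + a]addrC
    [2^-1 + a]addrC; field.
  by rewrite g0 s0.
Qed.
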